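(* For two oriented virtual knots $K$ and $K'$, we have the following. (i) ${\rm d}_{v\Delta^\circ}(K,K')\geq \frac{1}{3}\sum_{n\ne 0} |J_n(K)-J_n(K')|$. (ii) ${\rm d}_{vp}(K,K')\geq \frac{1}{4}\sum_{n\ne 0}|J_n(K)-J_n(K')|$. In particular, ${\rm u}_{v\Delta^\circ}(K)\geq \frac{1}{3}\sum_{n\ne 0}|J_n(K)|$ and ${\rm u}_{vp}(K)\geq \frac{1}{4}\sum_{n\ne 0}|J_n(K)|$.
   Context: Virtual knots. An oriented virtual knot diagram is a generic immersion of an oriented circle into the plane, each double point of which is either a real crossing (with over/under information) or a virtual crossing. The generalized Reidemeister moves are: the Reidemeister moves I, II, III for real crossings; their analogues in which all crossings are virtual; and the mixed move in which a strand having two virtual crossings is passed across a real crossing. An oriented virtual knot is an equivalence class of diagrams under generalized Reidemeister moves (and planar isotopy). $v\Delta^\circ$-moves. Consider a disk meeting the diagram in three oriented strands, any two of which cross exactly once, so that the three crossings are the vertices of a triangle whose sides, with the orientations of the strands, form a coherently oriented cycle. A $v\Delta^\circ$-move replaces three real crossings, where each of the three strands passes over at one of its two crossings and under at the other (the three crossings then have the same sign), by three virtual crossings, or is the inverse of this replacement. Virtualized pass-moves. Consider a disk meeting the diagram in a pair of parallel, disjoint strands oriented in opposite directions and another pair of parallel, disjoint strands oriented in opposite directions, where each strand of the first pair crosses each strand of the second pair exactly once. A $vp$-move replaces four real crossings at which both strands of the first pair pass over both strands of the second pair by four virtual crossings, or is the inverse of this replacement. Distances. For $X\in\{v\Delta^\circ,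 vp\}$, any two oriented virtual knots have diagrams related by finitely many $X$-moves and generalized Reidemeister moves. ${\rm d}_X(K,K')$ is the minimal number of $X$-moves required to deform a diagram of $K$ into that of $K'$ (generalized Reidemeister moves being used freely), and ${\rm u}_X(K)={\rm d}_X(K,O)$, where $O$ is the trivial knot. Writhes. The Gauss diagram $G$ of a diagram of $K$ is the oriented circle that is the preimage of the immersion, with a chord joining the two preimages of each real crossing, oriented from the overcrossing to the undercrossing and equipped with the sign of the crossing. If a chord has sign $\varepsilon$, its initial endpoint is given the sign $-\varepsilon$ and its terminal endpoint the sign $\varepsilon$. For a chord $\gamma$, let $\alpha$ be the open arc of the circle running, along its orientation, from the initial endpoint of $\gamma$ to its terminal endpoint; the index ${\rm Ind}(\gamma)$ is the sum of the signs of all endpoints of chords on $\alpha$. For $n\neq 0$, the $n$-writhe $J_n(K)$ is the sum of the signs of all chords of index $n$; it is an invariant of $K$. *)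

(* Defs.v *)
From HB Require Import structures.
From Stdlib Require Import Relation_Operators.
From mathcomp Require Import all_boot all_order all_algebra generic_quotient.
From mathcomp Require Import lra.
From mathcomp Require Import all_classical all_reals all_analysis.

Set Implicit Arguments.
Unset Strict Implicit.
Unset Printing Implicit Defensive.

Import Order.TTheory GRing.Theory Num.Theory.
Import numFieldNormedType.Exports.

Local Open Scope classical_set_scope.
Local Open Scope quotient_scope.
Local Open Scope ring_scope.

Notation plane R := (R * R)%type.

Section Plane.
Variable R : realType.

Definition det2 (u v : plane R) : R := u.1 * v.2 - u.2 * v.1.

Definition tangent_map (f : plane R -> plane R) (p v : plane R) : plane R :=
  'd f p v.

Definition C1map (f : plane R -> plane R) : Prop :=
  (forall p, differentiable f p) /\
  (forall v, continuous (fun p => tangent_map f p v)).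

Definition diffeo (f : plane R -> plane R) : Prop :=
  C1map f /\ exists g, [/\ C1map g, cancel f g & cancel g f].

Definition orientation_preserving (f : plane R -> plane R) : Prop :=
  forall p, 0 < det2 (tangent_map f p (1, 0)) (tangent_map f p (0, 1)).

Definition unit_disk : set (plane R) := [set p | p.1 ^+ 2 + p.2 ^+ 2 < 1].

(* The time parameter ranges over R rather than [0, 1]: an isotopy defined
   on [0, 1] can be extended by constants. *)
Definition isotopy (H : R -> plane R -> plane R) : Prop :=
  [/\ forall t, diffeo (H t),
      continuous (fun tp : R * plane R => H tp.1 tp.2),
      forall v, continuous (fun tp : R * plane R => tangent_map (H tp.1) tp.2 v)
    & forall p, H 0 p = p].

(* Orientation-preserving C^1 diffeomorphisms of the oriented circle R/Z,
   lifted to R. *)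
Definition circle_reparam (r : R -> R) : Prop :=
  [/\ forall s, r (s + 1) = r s + 1,
      forall s, derivable r s 1,
      continuous (derive1 r)
    & forall s, 0 < derive1 r s].

End Plane.

Section Diagrams.
Variable R : realType.

(* The oriented circle is R/Z; two parameters denote the same point of the
   circle when they differ by an integer. *)
Definition double_point (c : R -> plane R) (s t : R) : Prop :=
  c s = c t /\ (s - t \isn't a Num.int).

(* [over s t] means that s and t are the two preimages of a real crossing and
   that the strand through s is the upper one; the double points not related
   by [over] are the virtual crossings. *)
Record diagram := Diagram {
  curve : R -> plane R;
  over : R -> R -> Prop;
  curve_periodic : forall s, curve (s + 1) = curve s;
  curve_derivable : forall s, derivable curve s 1;
  curve_C1 : continuous (derive1 curve);
  curve_immersion : forall s, derive1 curve s != 0;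
  curve_double : forall s t u, double_point curve s t ->
    double_point curve s u -> t - u \is a Num.int;
  curve_transverse : forall s t, double_point curve s t ->
    det2 (derive1 curve s) (derive1 curve t) != 0;
  curve_finite :
    finite_set [set s | 0 <= s < 1 /\ exists t, double_point curve s t];
  over_double : forall s t, over s t -> double_point curve s t;
  over_asym : forall s t, over s t -> ~ over t s;
  over_periodic : forall s t (m n : int),
    over s t -> over (s + m%:~R) (t + n%:~R)
}.

HB.instance Definition _ := gen_eqMixin diagram.
HB.instance Definition _ := gen_choiceMixin diagram.

Definition planar_isotopic (D D' : diagram) : Prop :=
  exists H r, [/\ isotopy H, circle_reparam r,
    forall s, curve D' s = H 1 (curve D (r s))
  & forall s t, over D' s t <-> over D (r s) (r t)].

End Diagrams.

Section Moves.
Variable R : realType.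

(* A model of the part of a diagram inside a disk: k strands, each a curve
   traversed as its parameter increases from -1 to 1, which is proper in the
   open unit disk, together with the crossing information:
   [tover i u j v] means that, if strand i at parameter u meets strand j at
   parameter v, then the crossing is real and strand i is the upper one. *)
Record tangle k := Tangle {
  strand : 'I_k -> R -> plane R;
  tover : 'I_k -> R -> 'I_k -> R -> Prop
}.

(* The part of D in the disk f @` unit_disk is the image by f of the model T,
   the i-th strand being run through (up to the reparametrization r i) when the
   parameter is in ]a i, b i[. *)
Definition meets_disk_in (D : diagram R) (f : plane R -> plane R) k
    (T : tangle k) (a b : 'I_k -> R) : Prop :=
  exists r : 'I_k -> R -> R,
  [/\ forall s, (f @` @unit_disk R) (curve D s) <->
        exists i (n : int), a i < s + n%:~R < b i,
      forall i j s (n : int), a i < s < b i -> a j < s + n%:~R < b j ->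
        i = j /\ n = 0,
      forall i,
        [/\ forall s, a i < s < b i -> derivable (r i) s 1 /\ 0 < derive1 (r i) s
          & r i @` [set s | a i < s < b i] = [set u | -1 < u < 1]],
      forall i s, a i < s < b i -> curve D s = f (strand T i (r i s))
    & forall i j s t, a i < s < b i -> a j < t < b j ->
        double_point (curve D) s t ->
        (over D s t <-> tover T i (r i s) j (r j t))].

(* D' is obtained from D by replacing, inside a disk, a tangle modelled on T by
   a tangle modelled on T'.  Corresponding strands of T and T' occupy the same
   parameter interval of the circle, which can always be achieved by
   reparametrizing.  As both diagrams agree outside the disk, f and f' match the
   endpoints of the strands of T and T'; they need not be equal, because the
   strands of T and T' need not fit together smoothly. *)
Definition local_move k (T T' : tangle k) (D D' : diagram R) : Prop :=
  exists f f' (a b : 'I_k -> R),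
  let U := f @` @unit_disk R in
  [/\ [/\ diffeo f, orientation_preserving f, diffeo f',
          orientation_preserving f' & f' @` @unit_disk R = U],
      meets_disk_in D f T a b,
      meets_disk_in D' f' T' a b,
      forall s, ~ U (curve D s) -> curve D' s = curve D s
    & forall s t, ~ U (curve D s) -> ~ U (curve D t) ->
        (over D' s t <-> over D s t)].

Definition no_over k : 'I_k -> R -> 'I_k -> R -> Prop := fun _ _ _ _ => False.

Definition strand_over k (h : rel 'I_k) : 'I_k -> R -> 'I_k -> R -> Prop :=
  fun i _ j _ => h i j.

(* The orientation of the strands i such that o i is reversed. *)
Definition orient k (o : 'I_k -> bool) (c : 'I_k -> R -> plane R) :
    'I_k -> R -> plane R :=
  fun i u => c i ((-1) ^+ o i * u).

Definition segment (p q : plane R) (u : R) : plane R :=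
  ((1 - u) / 2) *: p + ((1 + u) / 2) *: q.

(* The double point is (0, 1/5), at the parameters -1/2 and 1/2. *)
Definition curl (u : R) : plane R :=
  (u * (4 * u ^+ 2 - 1) / 5, 4 * u ^+ 2 / 5).

Inductive crossing_type := FirstOver | SecondOver | Virtual.

Definition RI_over (x : crossing_type) : 'I_1 -> R -> 'I_1 -> R -> Prop :=
  fun _ u _ v => match x with
                 | FirstOver => u < v
                 | SecondOver => v < u
                 | Virtual => False
                 end.

(* A segment crossed by an arc of parabola at the points (-2/5, 0) and
   (2/5, 0). *)
Definition bigon (i : 'I_2) (u : R) : plane R :=
  if i == 0 :> nat then (u, 0) else (4 * u / 5, (4 * u ^+ 2 - 1) / 5).

Definition parallel (i : 'I_2) (u : R) : plane R :=
  if i == 0 :> nat then (u, 0) else (4 * u / 5, 3 / 5).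

Definition RII_over (x : crossing_type) : rel 'I_2 :=
  fun i j => match x with
             | FirstOver => (i < j)%N
             | SecondOver => (j < i)%N
             | Virtual => false
             end.

(* Three segments forming the triangle of vertices (-1/5, 0), (1/5, 0) and
   (0, 1/5), whose sides they orient coherently (counterclockwise). *)
Definition triangle (i : 'I_3) : R -> plane R :=
  match val i with
  | 0%N => segment (-1, 0) (1, 0)
  | 1%N => segment (4 / 5, - (3 / 5)) (- (3 / 5), 4 / 5)
  | _ => segment (3 / 5, 4 / 5) (- (4 / 5), - (3 / 5))
  end.

(* The other side of a Reidemeister move III: the endpoints on the unit circle
   are in the same cyclic order, and each strand meets the two others in the
   opposite order. *)
Definition opposite_triangle (i : 'I_3) (u : R) : plane R :=
  - triangle i (- u).

(* Upper, middle and lower strand; or three virtual crossings; or one real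
   crossing and a strand with two virtual crossings. *)
Inductive RIII_over : rel 'I_3 -> Prop :=
| RIII_real (height : 'I_3 -> nat) of injective height :
    RIII_over (fun i j => height j < height i)%N
| RIII_virtual : RIII_over (fun _ _ => false)
| RIII_mixed (i0 j0 : 'I_3) of i0 != j0 :
    RIII_over (fun i j => (i == i0) && (j == j0)).

Inductive reidemeister : forall k, tangle k -> tangle k -> Prop :=
| RI (o : 'I_1 -> bool) (x : crossing_type) :
    reidemeister
      (Tangle (orient o (fun=> curl)) (RI_over x))
      (Tangle (orient o (fun=> segment (- (3 / 5), 4 / 5) (3 / 5, 4 / 5)))
              (@no_over 1))
| RII (o : 'I_2 -> bool) (x : crossing_type) :
    reidemeister
      (Tangle (orient o bigon) (strand_over (RII_over x)))
      (Tangle (orient o parallel) (@no_over 2))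
| RIII (o : 'I_3 -> bool) (h : rel 'I_3) of RIII_over h :
    reidemeister
      (Tangle (orient o triangle) (strand_over h))
      (Tangle (orient o opposite_triangle) (strand_over h)).

(* With x, strand i passes over strand i + 1 mod 3; without x, under it. *)
Definition vDelta_over (x : bool) : rel 'I_3 :=
  fun i j => if x then j == ordS i else i == ordS j.

(* With w, the triangle is oriented clockwise. *)
Inductive vDelta_tangles : tangle 3 -> tangle 3 -> Prop :=
| VDelta (w x : bool) :
    vDelta_tangles
      (Tangle (orient (fun=> w) triangle) (strand_over (vDelta_over x)))
      (Tangle (orient (fun=> w) triangle) (@no_over 3)).

(* Two horizontal strands (the first pair) and two vertical ones, with
   opposite orientations in each pair. *)
Definition grid (i : 'I_4) (u : R) : plane R :=
  match val i with
  | 0%N => (4 * u / 5, 3 / 5)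
  | 1%N => (- (4 * u / 5), - (3 / 5))
  | 2%N => (3 / 5, 4 * u / 5)
  | _ => (- (3 / 5), - (4 * u / 5))
  end.

Definition vp_over : rel 'I_4 := fun i j => (i < 2)%N && (2 <= j)%N.

(* The booleans reverse the orientations of both strands of a pair. *)
Inductive vp_tangles : tangle 4 -> tangle 4 -> Prop :=
| VP (w w' : bool) :
    let o := fun i : 'I_4 => if (i < 2)%N then w else w' in
    vp_tangles
      (Tangle (orient o grid) (strand_over vp_over))
      (Tangle (orient o grid) (@no_over 4)).

Definition vDelta_move (D D' : diagram R) : Prop :=
  exists T T', vDelta_tangles T T' /\
    (local_move T T' D D' \/ local_move T T' D' D).

Definition vp_move (D D' : diagram R) : Prop :=
  exists T T', vp_tangles T T' /\
    (local_move T T' D D' \/ local_move T T' D' D).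

Definition reidemeister_move (D D' : diagram R) : Prop :=
  exists k (T T' : tangle k), reidemeister T T' /\ local_move T T' D D'.

Definition equivalent : diagram R -> diagram R -> Prop :=
  clos_refl_sym_trans _
    (fun D D' => planar_isotopic D D' \/ reidemeister_move D D').

Definition equivalentb (D D' : diagram R) : bool := `[< equivalent D D' >].

Lemma equivalentb_refl : reflexive equivalentb.
Proof. by move=> D; apply/asboolP/rst_refl. Qed.

Lemma equivalentb_sym : symmetric equivalentb.
Proof.
by move=> D D'; apply/asboolP/asboolP => ?; apply: rst_sym.
Qed.

Lemma equivalentb_trans : transitive equivalentb.
Proof.
move=> D2 D1 D3 /asboolP h12 /asboolP h23; apply/asboolP.
exact: rst_trans h12 h23.
Qed.

Canonical equivalentb_equiv :=
  EquivRel equivalentb equivalentb_refl equivalentb_sym equivalentb_trans.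

Definition virtual_knot := {eq_quot equivalentb_equiv}.

(* D can be deformed into D' with exactly n X-moves. *)
Inductive deforms (X : diagram R -> diagram R -> Prop) :
    nat -> diagram R -> diagram R -> Prop :=
| deforms0 D D' of equivalent D D' : deforms X 0 D D'
| deformsS n D1 D2 D3 D4 of deforms X n D1 D2 & X D2 D3 & equivalent D3 D4 :
    deforms X n.+1 D1 D4.

(* The infimum is a minimum, as some number of moves always suffices for the
   moves considered here. *)
Definition distance (X : diagram R -> diagram R -> Prop)
    (K K' : virtual_knot) : \bar R :=
  ereal_inf [set n%:R%:E | n in [set n : nat | exists D D',
    [/\ \pi_virtual_knot D = K, \pi_virtual_knot D' = K' & deforms X n D D']]].

End Moves.

Section Writhes.
Variable R : realType.
Variable D : diagram R.

(* A chord of the Gauss diagram is given by parameters c.1 of its initial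
   endpoint and c.2 of its terminal endpoint, the latter chosen such that
   ]c.1, c.2[ is the open arc from the former to the latter.  Translating both
   parameters by an integer gives the same chord. *)
Definition chords : set (R * R) :=
  [set c | over D c.1 c.2 /\ c.1 < c.2 < c.1 + 1].

(* The sign is 1 if the directions of the upper and lower strands form a
   positively oriented basis of the plane. *)
Definition chord_sign (c : R * R) : int :=
  sgz (det2 (derive1 (curve D) c.1) (derive1 (curve D) c.2)).

Definition chord_index (c : R * R) : int :=
  (\sum_(d \in [set d | chords d /\ c.1 < d.1 < c.2]) - chord_sign d) +
  (\sum_(d \in [set d | chords d /\ c.1 < d.2 < c.2]) chord_sign d).

Definition diagram_writhe (n : int) : int :=
  \sum_(c \in [set c | [/\ chords c, 0 <= c.1 < 1 & chord_index c = n]])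
    chord_sign c.

End Writhes.

Section KnotWrithe.
Variable R : realType.

Definition writhe (n : int) (K : virtual_knot R) : int :=
  diagram_writhe (repr K) n.

End KnotWrithe.

Section TrivialKnot.
Variable R : realType.

Definition circle (s : R) : plane R := (cos (2 * pi * s), sin (2 * pi * s)).

Let circle' (s : R) : plane R :=
  (- sin (2 * pi * s) * (2 * pi), cos (2 * pi * s) * (2 * pi)).

Let circle_is_derive (s : R) :
  differentiable circle s /\ 'd circle s 1 = circle' s :> plane R.
Proof.
have dl : is_derive s (1 : R) (fun s : R => 2 * pi * s) (2 * pi).
  rewrite -[X in is_derive _ _ _ X]mulr1; exact: is_deriveZ.
have [+ ec] := is_derive1_comp (is_derive_cos (2 * pi * s)) dl.
have [+ es] := is_derive1_comp (is_derive_sin (2 * pi * s)) dl.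
move=> /derivable1_diffP dsin /derivable1_diffP dcos.
split; first exact: differentiable_pair.
rewrite diff_pair // /circle' -ec -es.
by rewrite !deriveE.
Qed.

Lemma circle_periodic s : circle (s + 1) = circle s.
Proof.
by rewrite /circle mulrDr mulr1 mulr_natl cosD2pi sinD2pi.
Qed.

Lemma circle_derivable s : derivable circle s 1.
Proof. by apply: diff_derivable; case: (circle_is_derive s). Qed.

Lemma circle_derive s : derive1 circle s = circle' s.
Proof. by have [? <-] := circle_is_derive s; rewrite derive1E'. Qed.

Lemma circle_C1 : continuous (derive1 circle).
Proof.
rewrite (_ : derive1 circle = circle'); last exact/funext/circle_derive.
have lin : continuous (fun s : R => 2 * pi * s) by exact: mulrl_continuous.
have csin : continuous (fun s : R => sin (2 * pi * s)).
  by move=> s; apply: continuous_comp (lin s) _; exact: continuous_sin.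
have ccos : continuous (fun s : R => cos (2 * pi * s)).
  by move=> s; apply: continuous_comp (lin s) _; exact: continuous_cos.
have cpair (f g : R -> R) : continuous f -> continuous g ->
    continuous (fun s => (f s, g s) : plane R).
  by move=> cf cg s; exact: (cvg_pair (cf s) (cg s)).
apply: cpair => s.
  by apply: cvgM; [apply: cvgN; exact: csin|exact: cvg_cst].
by apply: cvgM; [exact: ccos|exact: cvg_cst].
Qed.

Lemma circle_immersion s : derive1 circle s != 0.
Proof.
rewrite circle_derive /circle'; apply/eqP => -[/eqP + /eqP].
have p0 : 2 * pi != 0 :> R by rewrite mulf_neq0// ?gt_eqF ?pi_gt0.
rewrite !mulf_eq0 -mulf_eq0 (negbTE p0) !orbF oppr_eq0 => /eqP s0 /eqP c0.
have := cos2Dsin2 (2 * pi * s).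
by rewrite s0 c0 expr0n addr0 => /eqP; rewrite eq_sym oner_eq0.
Qed.

Lemma circle_periodicz s (m : int) : circle (s + m%:~R) = circle s.
Proof.
have nat_case n u : circle (u + n%:R) = circle u.
  by elim: n u => [|n IH] u; rewrite ?addr0// -natr1 addrA circle_periodic.
case: m => n; first exact: nat_case.
by rewrite NegzE mulrNz -(nat_case n.+1 (s - _)) subrK.
Qed.

Lemma circle_simple s t : ~ double_point circle s t.
Proof.
case=> -[ec es] /negP; apply.
have c1 : cos (2 * pi * (s - t)) = 1.
  by rewrite mulrBr cosB ec es -!expr2 cos2Dsin2.
pose x := s - t - (Num.floor (s - t))%:~R.
have x01 : 0 <= x < 1.
  have /andP[h1 h2] := floor_itv (s - t).
  by rewrite /x subr_ge0 h1 ltrBlDl addrC -intrD1 addrC.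
have cx : cos (2 * pi * x) = 1.
  rewrite -[RHS]c1; have := circle_periodicz x (Num.floor (s - t)).
  by rewrite subrK /circle => /(congr1 fst) /= ->.
have sx : sin (pi * x) = 0.
  move: cx; rewrite -mulrA mulr_natl cos_mulr2n cos2sin2 => cx.
  apply/eqP; rewrite -sqrf_eq0; apply/eqP.
  by move: cx; rewrite mulr2n; set y := sin _ ^+ 2 => cx; lra.
have x0 : x = 0.
  apply/eqP/negP => /negP x0.
  have : 0 < sin (pi * x).
    apply: sin_gt0_pi; rewrite mulr_gt0 ?pi_gt0//=; last first.
      by rewrite lt_neqAle eq_sym x0; case/andP: x01.
    by rewrite gtr_pMr ?pi_gt0//; case/andP: x01.
  by rewrite sx ltxx.
apply/intrP; exists (Num.floor (s - t)).
by apply/eqP; rewrite -subr_eq0; apply/eqP.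
Qed.

Lemma circle_finite :
  finite_set [set s | 0 <= s < 1 /\ exists t, double_point circle s t].
Proof.
rewrite (_ : mkset _ = set0); first exact: finite_set0.
by apply/seteqP; split=> // s [_ [t /circle_simple]].
Qed.

Definition circle_diagram : diagram R :=
  @Diagram R circle (fun _ _ => False) circle_periodic circle_derivable
    circle_C1 circle_immersion
    (fun _ _ _ h _ => False_ind _ (circle_simple h))
    (fun _ _ h => False_ind _ (circle_simple h))
    circle_finite
    (fun _ _ h => False_ind _ h)
    (fun _ _ _ h => h)
    (fun _ _ _ _ h => h).

Definition trivial_knot : virtual_knot R := \pi_(virtual_knot R) circle_diagram.

Definition unknotting (X : diagram R -> diagram R -> Prop)
    (K : virtual_knot R) : \bar R :=
  distance X K trivial_knot.

End TrivialKnot.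

(* Submission.v *)
From HB Require Import structures.
From mathcomp Require Import all_boot all_order all_algebra generic_quotient.
From mathcomp Require Import lra ring.
From mathcomp Require Import all_classical all_reals all_analysis.
Require Import Defs.

Set Implicit Arguments.
Unset Strict Implicit.
Unset Printing Implicit Defensive.

Import Order.TTheory GRing.Theory Num.Theory.
Import numFieldNormedType.Exports.

Local Open Scope classical_set_scope.
Local Open Scope quotient_scope.
Local Open Scope ring_scope.

(* For a parameter s on the circle let e(s) be the sign of the endpoint of a
   chord at s, and 0 if there is none.  As the two endpoints of a chord have
   opposite signs, e has sum 0 over the circle and hence a periodic primitive G,
   and a chord from s to t has index G(t) - G(s) - e(s).

   In a local move, the sum of e along a strand of the disk is the same before
   and after the move: the endpoints on a strand cancel in moves I and II, in a
   vDelta-move and in a vp-move, and are only permuted in a move III.  So G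
   changes by a constant outside of the disk, and the chords outside of the disk
   keep their index.  The chords inside contribute equally to every J_n with
   n != 0 before and after a Reidemeister move (the chord of a move I has index
   0, those of a move II have the same index and opposite signs, those of a
   move III keep their indices), whereas a vDelta-move creates or deletes 3
   chords and a vp-move 4, each of which changes a single J_n by 1. *)

(** * Sums over intervals of the circle *)

(** Indices and writhes are both written as sums of locally finite periodic functions over half-open
    intervals [x, y[, which concatenate without correction; a writhe becomes the sum of a density
    carried by the initial endpoints, so that one set of lemmas localizes both. The delicate points
    lie on the boundary circle of the disk. The two diagrams of a move agree only outside of the
    open disk, and a crossing may lie on the boundary, where an outer arc touches the circle; its
    sign involves the velocity at an entrance or an exit of a strand. This velocity is recovered
    from one side only, which is possible because the ends of the models are distinct, so that an
    entrance is never an exit. Likewise, the running sum at an entrance has to include the sign of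
    an endpoint that may sit there. Inside the disk everything is reduced to finite tables of
    crossings of the model curves. The rest of the diagram enters only through the values of G at
    the entrances, one integer per strand, up to a common constant. These integers are unknown but
    the same for all n, so the bounds can be summed over n. *)

(* The locks keep conversion from unfolding the sums when it compares two of
   them at different real arguments. *)
HB.lock Definition isum (R : realType) (h : R -> int) (x y : R) : int :=
  \sum_(z \in [set z | x <= z < y]) h z.

Section IntervalSums.
Variable R : realType.
Implicit Types (h : R -> int) (x y z : R).

Lemma isumE h x y : isum h x y = \sum_(z \in [set z | x <= z < y]) h z.
Proof. by rewrite isum.unlock. Qed.

Definition locally_finite h :=
  forall x y, finite_set [set z | x <= z < y /\ h z != 0].

Definition periodic1 (T : Type) (h : R -> T) := forall x, h (x + 1) = h x.

(** The list only has to contain the support, so that sums of several functions, or over several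
    intervals, can be compared over one common list. *)
Lemma isum_seq (s : seq R) h x y : uniq s ->
    (forall z, x <= z < y -> h z != 0 -> z \in s) ->
  isum h x y = \sum_(z <- s | x <= z < y) h z.
Proof.
move=> us hs; rewrite isumE (bigfs _ us) // => z xzy.
by apply: contraNeq; exact: hs.
Qed.

Lemma locally_finite_seq h x y : locally_finite h ->
  exists2 s : seq R, uniq s & forall z, x <= z < y -> h z != 0 -> z \in s.
Proof.
move=> /(_ x y) fh; exists (finmap.enum_fset (fset_set [set z | x <= z < y /\ h z != 0])).
  exact: finmap.fset_uniq.
by move=> z xzy hz; rewrite in_fset_set//; apply/mem_set.
Qed.

Lemma eq_isum h h' x y : (forall z, x <= z < y -> h z = h' z) ->
  isum h x y = isum h' x y.
Proof. by move=> hh'; rewrite !isumE; apply: eq_fsbigr => z; rewrite inE => /hh'. Qed.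

Lemma isum_eq0 h x y : (forall z, x <= z < y -> h z = 0) -> isum h x y = 0.
Proof. by move=> h0; rewrite isumE; apply: fsbig1 => z /h0. Qed.

Lemma isum_ge h x y : y <= x -> isum h x y = 0.
Proof.
move=> yx; apply: isum_eq0 => z /andP[xz zy].
by have := le_lt_trans xz zy; rewrite ltNge yx.
Qed.

Lemma isum_cat h x y z : locally_finite h -> x <= y -> y <= z ->
  isum h x z = isum h x y + isum h y z.
Proof.
move=> lf xy yz; have [s us hs] := locally_finite_seq x z lf.
have sub u v : x <= u -> v <= z ->
    forall t, u <= t < v -> h t != 0 -> t \in s.
  move=> xu vz t /andP[ut tv]; apply: hs.
  by rewrite (le_trans xu ut) (lt_le_trans tv vz).
rewrite (isum_seq us hs) (isum_seq us (sub x y _ _))// (isum_seq us (sub y z _ _))//.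
rewrite (bigID (fun t => t < y)) /=; congr (_ + _); apply: eq_bigl => t.
  case: (ltP t y) => ty; rewrite ?andbT ?andbF//.
  by rewrite (lt_le_trans ty yz) andbT.
by case: (leP y t) => ty; rewrite ?andbT ?andbF//= (le_trans xy ty).
Qed.

Lemma isum_add h h' x y : locally_finite h -> locally_finite h' ->
  isum (fun z => h z + h' z) x y = isum h x y + isum h' x y.
Proof.
move=> lf lf'; have [s us hs] := locally_finite_seq x y lf.
have [s' us' hs'] := locally_finite_seq x y lf'.
have sub (u : R -> int) z : u z != 0 ->
    (u z != 0 -> h z != 0 \/ h' z != 0) -> x <= z < y ->
    z \in undup (s ++ s').
  move=> uz hh xzy; rewrite mem_undup mem_cat; apply/orP.
  by case: (hh uz) => [/(hs _ xzy)|/(hs' _ xzy)]; [left|right].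
rewrite !(@isum_seq (undup (s ++ s'))) ?undup_uniq//; first exact: big_split.
- by move=> z xzy hz; apply: (sub h' z) => //; right.
- by move=> z xzy hz; apply: (sub h z) => //; left.
- move=> z xzy hz; apply: (sub (fun z => h z + h' z) z) => // _.
  have [hz0|] := eqVneq (h z) 0; last by left.
  by right; move: hz; rewrite hz0 add0r.
Qed.

Lemma isum_sum (I : finType) (F : I -> R -> int) x y :
    (forall i, locally_finite (F i)) ->
  isum (fun z => \sum_i F i z) x y = \sum_i isum (F i) x y.
Proof.
move=> lf.
have [s us hs] : exists2 s : seq R, uniq s &
    forall i z, x <= z < y -> F i z != 0 -> z \in s.
  have fin : finite_set
      (\bigcup_(i in [set: I]) [set z | x <= z < y /\ F i z != 0]).
    by apply: bigcup_finite => [|i _]; [exact: finite_finset|exact: lf].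
  exists (finmap.enum_fset
      (fset_set (\bigcup_(i in [set: I]) [set z | x <= z < y /\ F i z != 0]))).
    exact: finmap.fset_uniq.
  by move=> i z xzy Fi; rewrite in_fset_set//; apply/mem_set; exists i.
under [RHS]eq_bigr => i _ do rewrite (isum_seq us (hs i)).
rewrite (isum_seq us); first exact: exchange_big.
move=> z xzy; apply: contraNT => zs.
rewrite big1// => i _; apply/eqP; apply: contraNT zs; exact: hs.
Qed.

Lemma isum_shift h c x y :
  isum (fun z => h (z + c)) x y = isum h (x + c) (y + c).
Proof.
rewrite !isumE; apply/esym/reindex_fsbig; split.
- by move=> z /= /andP[xz zy]; rewrite lerD2r ltrD2r xz.
- by move=> u v _ _ /addIr.
- move=> z /= /andP[xz zy]; exists (z - c) => /=; last by rewrite subrK.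
  by rewrite lerBrDr ltrBlDr xz.
Qed.

Lemma periodicz (T : Type) (h : R -> T) (n : int) x : periodic1 h -> h (x + n%:~R) = h x.
Proof.
move=> per; have nat_case m u : h (u + m%:R) = h u.
  by elim: m u => [|m IH] u; rewrite ?addr0// -natr1 addrA per.
case: n => m; first exact: nat_case.
by rewrite NegzE mulrNz -(nat_case m.+1 (x - _)) subrK.
Qed.

Lemma isum_periodz h (n : int) x y : periodic1 h ->
  isum h (x + n%:~R) (y + n%:~R) = isum h x y.
Proof.
move=> per; rewrite -isum_shift; apply: eq_isum => z _; exact: periodicz.
Qed.

Lemma floor_shift x : exists n : int, 0 <= x + n%:~R < 1.
Proof.
exists (- Num.floor x); rewrite mulrNz.
have /andP[] := floor_itv x; rewrite intrD1 => xl xu.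
by apply/andP; split; lra.
Qed.

(** With y the translate of x in [0, 1[, the window [y, y + 1[ is [y, 1[ followed by [1, y + 1[,
    which is a translate of [0, y[. *)
Lemma isum_period h x : locally_finite h -> periodic1 h ->
  isum h x (x + 1) = isum h 0 1.
Proof.
move=> lf per; have [n /andP[n0 n1]] := floor_shift x.
rewrite -(isum_periodz n x (x + 1) per) addrAC; set y := x + _ in n0 n1 *.
rewrite (@isum_cat h y 1)//; [|exact: ltW|by rewrite lerDr].
rewrite (@isum_cat h 0 y 1) ?(ltW n1)// [RHS]addrC; congr (_ + _).
by rewrite -(isum_periodz 1 0 y per) add0r.
Qed.

(** At most one of the two intervals is nonempty, so this is the primitive of h that vanishes at 0,
    with the correct sign on both sides of 0. *)
Definition prim h x : int := isum h 0 x - isum h x 0.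

Lemma primB h x y : locally_finite h -> x <= y ->
  prim h y - prim h x = isum h x y.
Proof.
move=> lf xy; rewrite /prim; case: (leP 0 x) => x0.
  rewrite (@isum_cat h 0 x y)// (isum_ge _ x0) (isum_ge _ (le_trans x0 xy)).
  by ring.
rewrite (isum_ge _ (ltW x0)); case: (leP 0 y) => y0.
  by rewrite (@isum_cat h x 0 y)// ?(isum_ge _ y0) ?(ltW x0)//; ring.
by rewrite (isum_ge _ (ltW y0)) (@isum_cat h x y 0)// ?(ltW y0)//; ring.
Qed.

Lemma prim_periodz h (n : int) x : locally_finite h -> periodic1 h ->
  isum h 0 1 = 0 -> prim h (x + n%:~R) = prim h x.
Proof.
move=> lf per h0; apply: periodicz => {n}{}x.
apply/eqP; rewrite -subr_eq0 primB ?lerDl//.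
by rewrite isum_period// h0.
Qed.

Lemma locally_finite_periodic h : periodic1 h ->
  finite_set [set z | 0 <= z < 1 /\ h z != 0] -> locally_finite h.
Proof.
move=> per fin x y; have [N [Nx Ny]] : exists N : nat, - N%:R <= x /\ y <= N%:R.
  exists (Num.truncn (`|x| + `|y|)).+1.
  have /ltW tr := truncnS_gt (`|x| + `|y|).
  have := ler_norm y; have := ler_norm (- x); rewrite normrN.
  have := normr_ge0 x; have := normr_ge0 y.
  by move: tr; set t := _%:R; move=> *; split; lra.
(* Points of [-N, N[ have the form u + m - N with u in [0, 1[ and m < 2N a natural number. *)
apply: (@sub_finite_set _ _ ((fun p : R * nat => p.1 + p.2%:R - N%:R) @`
    ([set z | 0 <= z < 1 /\ h z != 0] `*` `I_(2 * N)%N))); last first.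
  by apply: finite_image; apply: finite_setX => //; exact: finite_II.
move=> z [/andP[xz zy] hz].
have zN : 0 <= z + N%:R by rewrite -lerBlDr sub0r (le_trans Nx).
have /andP[t1 t2] := truncn_itv zN.
exists (z + N%:R - (Num.truncn (z + N%:R))%:R, Num.truncn (z + N%:R)).
  split => /=.
    rewrite subr_ge0 t1 ltrBlDl natr1 t2; split => //.
    set t := Num.truncn _.
    have -> : z + N%:R - t%:R = z + (N%:Z - t%:Z)%:~R by rewrite rmorphB/= addrA.
    by rewrite periodicz.
  rewrite -(ltr_nat R); apply: le_lt_trans t1 _.
  by rewrite natrM mulr_natl mulr2n ltrD2r (lt_le_trans zy).
by rewrite /= subrK addrK.
Qed.
End IntervalSums.

(** * Functions supported on the strands of a disk *)

Section StrandSums.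
Variable R : realType.
Implicit Types (h : R -> int) (x y z : R).

Lemma isum_reparam h (r : R -> R) x y : {mono r : s t / s <= t} ->
  (forall t, exists s, r s = t) ->
  isum (fun s => h (r s)) x y = isum h (r x) (r y).
Proof.
move=> rm rs; rewrite !isumE; apply/esym/reindex_fsbig; split.
- by move=> z /= /andP[xz zy]; rewrite rm xz (leW_mono rm).
- by move=> u v _ _; exact: (inc_inj rm).
- move=> z /= /andP[xz zy]; have [s e] := rs z; exists s => //=.
  by rewrite -rm e xz -(leW_mono rm) e.
Qed.

Lemma locally_finite_sub h h' : (forall z, h' z != 0 -> h z != 0) ->
  locally_finite h -> locally_finite h'.
Proof.
move=> hh' lf x y; apply: sub_finite_set (lf x y) => z [xzy /hh' hz].
by split.
Qed.

Lemma locally_finiteB h h' : locally_finite h -> locally_finite h' ->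
  locally_finite (fun z => h z - h' z).
Proof.
move=> lf lf' x y.
apply: (@sub_finite_set _ _ ([set z | x <= z < y /\ h z != 0] `|`
    [set z | x <= z < y /\ h' z != 0])); last by rewrite finite_setU; split.
move=> z [xzy hz]; have [h0|h0] := eqVneq (h z) 0; last by left.
by right; split => //; move: hz; rewrite h0 sub0r oppr_eq0.
Qed.

Lemma isumN h x y : isum (fun z => - h z) x y = - isum h x y.
Proof.
rewrite !isumE -mulN1r mulr_fsumr.
by apply: eq_fsbigr => z _; rewrite mulN1r.
Qed.

Lemma isum_sub h h' x y : locally_finite h -> locally_finite h' ->
  isum (fun z => h z - h' z) x y = isum h x y - isum h' x y.
Proof.
move=> lf lf'; rewrite isum_add// ?isumN//.
by apply: locally_finite_sub lf' => z; rewrite oppr_eq0.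
Qed.

Lemma prim_sub h h' x : locally_finite h -> locally_finite h' ->
  prim (fun z => h z - h' z) x = prim h x - prim h' x.
Proof. by move=> lf lf'; rewrite /prim !isum_sub//; ring. Qed.

Lemma isum_fin h x y (P : finType) (z : P -> R) (Q : pred P) :
    {in Q &, injective z} -> (forall p, Q p -> x <= z p < y) ->
    (forall t, x <= t < y -> h t != 0 -> exists2 p, Q p & t = z p) ->
  isum h x y = \sum_(p | Q p) h (z p).
Proof.
move=> inj zQ supp; rewrite (@isum_seq _ (map z (enum Q))).
- rewrite big_map big_enum_cond /=; apply: eq_bigl => p.
  by rewrite andb_idr//; exact: zQ.
- rewrite map_inj_in_uniq ?enum_uniq// => p q.
  by rewrite !mem_enum; exact: inj.
- move=> t txy ht; have [p Qp ->] := supp _ txy ht.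
  by apply: map_f; rewrite mem_enum.
Qed.

Section Strand.
Variables (a b : R) (h : R -> int).
Hypotheses (ab : a < b) (ba : b <= a + 1).
Hypotheses (per : periodic1 h) (lf : locally_finite h).
Hypothesis supp : forall s, (forall n : int, ~ (a < s + n%:~R < b)) -> h s = 0.

Let supp_gap s : b - 1 <= s <= a -> h s = 0.
Proof.
move=> /andP[bs sa]; apply: supp => n /andP[asn snb].
have n0 : 0 < n.
  by rewrite -(ltr_int R) -(ltrD2l s) addr0 (le_lt_trans sa).
have n1 : n < 1.
  rewrite -(ltr_int R) -(ltrD2l s) (lt_le_trans snb)//.
  by rewrite -lerBlDr.
by move: n0; rewrite gtz0_ge1 leNgt n1.
Qed.

Lemma isum_strand : isum h 0 1 = isum h a b.
Proof.
rewrite -(isum_period a lf per) (@isum_cat _ h a b)// ?(ltW ab)//.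
rewrite [X in _ + X]isum_eq0 ?addr0// => z /andP[bz za].
rewrite -(periodicz (-1) z per); apply: supp_gap.
by rewrite lerD2r bz/= lerBlDr ltW.
Qed.

(** The translate of x in ]a - 1, a] is off the strand, hence in the gap [b - 1, a], where h
    vanishes. The primitive is periodic because the sum of h over the circle is its sum over the
    strand, which is 0. *)
Lemma prim_strand x : isum h a b = 0 ->
  (forall n : int, ~ (a < x + n%:~R < b)) -> prim h x = prim h a.
Proof.
move=> h0 xout; have [n /andP[n0 n1]] := floor_shift (a - x).
have xa : x + (- n)%:~R <= a by rewrite mulrNz; lra.
rewrite -(prim_periodz (- n) x lf per) ?isum_strand//.
apply/eqP; rewrite eq_sym -subr_eq0 primB//.
apply/eqP/isum_eq0 => z /andP[xz za]; apply: supp_gap.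
rewrite (ltW za) andbT (le_trans _ xz)// leNgt.
apply/negP => xb; apply: (xout (- n + 1)); rewrite rmorphD/=.
move: xb; rewrite mulrNz => xb; apply/andP; split; lra.
Qed.
End Strand.
End StrandSums.

Section StrandIntervals.
Variables (R : realType) (k : nat) (a b : 'I_k -> R).
Implicit Types (h : R -> int) (s : R).

Definition disjoint_strands : Prop :=
  (forall i, a i < b i) /\
  (forall i j s (n : int), a i < s < b i -> a j < s + n%:~R < b j ->
     i = j /\ n = 0).

Definition on_strand i s : Prop := exists n : int, a i < s + n%:~R < b i.

Definition inside s : Prop := exists i, on_strand i s.

Hypothesis disj : disjoint_strands.

Lemma strand_length i : b i <= a i + 1.
Proof.
have [ab dj] := disj; rewrite leNgt; apply/negP => ba.
(* Were the strand longer than the circle, s and s + 1 would both lie on it. *)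
pose s := (a i + b i - 1) / 2; have := ab i => abi.
have [_ //] : i = i /\ 1%Z = 0 :> int.
apply: (dj i i s); rewrite /s; apply/andP; split => /=; lra.
Qed.

Lemma on_strandz i s (n : int) : on_strand i (s + n%:~R) <-> on_strand i s.
Proof.
split=> -[m sm]; last first.
  exists (m - n); rewrite rmorphB/=.
  by rewrite (_ : s + n%:~R + (m%:~R - n%:~R) = s + m%:~R)//; ring.
by exists (n + m); rewrite rmorphD/= addrA.
Qed.

Lemma inside_self i s : a i < s < b i -> inside s.
Proof. by move=> si; exists i, 0; rewrite addr0. Qed.

Lemma on_strand_uniq i j s : on_strand i s -> on_strand j s -> i = j.
Proof.
have [_ dj] := disj; move=> [m sm] [n sn].
have [|-> //] := dj i j _ (n - m) sm; rewrite rmorphB/=.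
by rewrite (_ : s + m%:~R + (n%:~R - m%:~R) = s + n%:~R)//; ring.
Qed.

(** If [a i] lay on an open strand, so would a slightly larger parameter, which also lies on strand
    i; disjointness would identify the two strands without translation, and [a i] would exceed
    itself. *)
Lemma start_outside i : ~ inside (a i).
Proof.
have [ab dj] := disj; move=> [j [n /andP[aj bj]]]; have := ab i => abi.
pose d := Num.min (b i - a i) (b j - (a i + n%:~R)) / 2.
have m0 : 0 < Num.min (b i - a i) (b j - (a i + n%:~R)).
  by rewrite lt_min !subr_gt0 abi.
have m1 : Num.min (b i - a i) (b j - (a i + n%:~R)) <= b i - a i.
  by rewrite ge_min lexx.
have m2 : Num.min (b i - a i) (b j - (a i + n%:~R)) <= b j - (a i + n%:~R).
  by rewrite ge_min lexx orbT.
have [e n0] : i = j /\ n = 0.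
  apply: (dj i j (a i + d)); rewrite /d; move: m0 m1 m2;
    set m := Num.min _ _ => *; apply/andP; split; lra.
by move: aj; rewrite n0 addr0 e ltxx.
Qed.

Let part h i s : int := if `[< on_strand i s >] then h s else 0.

Let partE h s : (forall s, ~ inside s -> h s = 0) -> h s = \sum_i part h i s.
Proof.
move=> h0; have [[i si]|/h0 hs] := pselect (inside s).
  rewrite (bigD1 i)//= big1 ?addr0 => [|j /eqP ji]; rewrite /part.
    by rewrite asboolT.
  by rewrite asboolF// => /(on_strand_uniq si) /esym.
by rewrite hs big1// => i _; rewrite /part; case: asboolP.
Qed.

Let part_per h i : periodic1 h -> periodic1 (part h i).
Proof.
move=> per s; rewrite /part per; congr (if _ then _ else _).
by apply: asbool_equiv_eq; have := on_strandz i s 1.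
Qed.

Let part_lf h i : locally_finite h -> locally_finite (part h i).
Proof.
by apply: locally_finite_sub => s; rewrite /part; case: ifP; rewrite ?eqxx.
Qed.

Let part_supp h i s : (forall n : int, ~ (a i < s + n%:~R < b i)) ->
  part h i s = 0.
Proof. by move=> sn; rewrite /part asboolF// => -[n /sn]. Qed.

Let isum_part h i : (forall s, ~ inside s -> h s = 0) ->
  isum (part h i) (a i) (b i) = isum h (a i) (b i).
Proof.
move=> h0; apply: eq_isum => s /andP[].
rewrite le_eqVlt => /orP[/eqP <- _|as_ sb].
  rewrite /part; case: asboolP => // _.
  by rewrite h0//; exact: start_outside.
by rewrite /part asboolT//; exists 0; rewrite addr0 as_.
Qed.

Lemma isum_strands h : locally_finite h -> periodic1 h ->
    (forall s, ~ inside s -> h s = 0) ->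
  isum h 0 1 = \sum_i isum h (a i) (b i).
Proof.
move=> lf per h0; rewrite (eq_isum (fun s _ => partE s h0)).
rewrite isum_sum => [|i]; last exact: part_lf.
apply: eq_bigr => i _; have [ab _] := disj.
rewrite (isum_strand (ab i) (strand_length i)
  (part_per i per) (part_lf i lf) (@part_supp h i)).
exact: isum_part.
Qed.

(** The primitive of the part of h on a single strand is constant off that strand, as this part has
    sum 0; these primitives add up to that of h. *)
Lemma prim_strands h x y : locally_finite h -> periodic1 h ->
    (forall s, ~ inside s -> h s = 0) -> (forall i, isum h (a i) (b i) = 0) ->
  ~ inside x -> ~ inside y -> prim h x = prim h y.
Proof.
move=> lf per h0 hi xo yo.
have primE z : prim h z = \sum_i prim (part h i) z.
  rewrite /prim !(eq_isum (fun s _ => partE s h0)).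
  rewrite !isum_sum => [|i|i]; [|exact: part_lf..].
  by rewrite -sumrB.
rewrite !primE; apply: eq_bigr => i _; have [ab _] := disj.
have prim_out z : ~ inside z -> prim (part h i) z = prim (part h i) (a i).
  move=> zo; apply: (prim_strand (ab i) (strand_length i) (part_per i per)
    (part_lf i lf) (@part_supp h i)); first by rewrite isum_part.
  by move=> n zn; apply: zo; exists i, n.
by rewrite !prim_out.
Qed.
End StrandIntervals.

(** * Endpoint signs and writhes *)

Definition linked (R : realType) (D : diagram R) (s t : R) : Prop :=
  over D s t \/ over D t s.

(* At a parameter that is not an endpoint of a chord the partner is the
   parameter itself, so that the endpoint sign is 0. *)
Definition partner (R : realType) (D : diagram R) (s : R) : R :=
  xget s [set t | linked D s t].

(** One determinant covers both sign conventions: at the lower preimage it gives the sign of the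
    chord and at the upper one the opposite sign, by antisymmetry. *)
HB.lock Definition endpoint_sign (R : realType) (D : diagram R) (s : R) : int :=
  sgz (det2 (derive1 (curve D) (partner D s)) (derive1 (curve D) s)).

Section EndpointSigns.
Variables (R : realType) (D : diagram R).
Implicit Types s t u : R.

Local Notation velocity := (derive1 (curve D)).
Local Notation linked := (linked D).
Local Notation partner := (partner D).
Local Notation endpoint_sign := (endpoint_sign D).

Lemma det2C (u v : plane R) : det2 u v = - det2 v u.
Proof. by rewrite /det2; ring. Qed.

Lemma sgz_det2C (u v : plane R) : sgz (det2 u v) = - sgz (det2 v u).
Proof. exact (etrans (congr1 (@sgz R) (det2C u v)) (sgzN _)). Qed.

Lemma isum_cond (h : R -> int) x y (Q : pred R) :
  \sum_(z \in [set z | x <= z < y /\ Q z]) h z =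
  isum (fun z => if Q z then h z else 0) x y.
Proof.
rewrite (_ : [set z | _] = [set z | x <= z < y] `&` [set z | Q z]); last first.
  by apply/seteqP; split.
rewrite isumE fsbig_mkcondr; apply: eq_fsbigr => z _.
by rewrite (_ : (z \in [set z | Q z]) = Q z)// ; apply/idP/idP; rewrite inE.
Qed.

Lemma curve_periodicz s (n : int) : curve D (s + n%:~R) = curve D s.
Proof. exact: (periodicz n s (curve_periodic D)). Qed.

Lemma velocity_periodicz s (n : int) : velocity (s + n%:~R) = velocity s.
Proof.
rewrite /derive1; under [in LHS]eq_fun do rewrite addrA !curve_periodicz.
by [].
Qed.


Lemma linked_sym s t : linked s t -> linked t s.
Proof. by case; [right|left]. Qed.

Lemma linkedz s t (m n : int) : linked s t -> linked (s + m%:~R) (t + n%:~R).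
Proof.
case=> st; first by left; exact: (over_periodic m n st).
by right; exact: (over_periodic n m st).
Qed.

Lemma double_point_sym s t : double_point (curve D) s t ->
  double_point (curve D) t s.
Proof. by case=> e ne; split=> //; rewrite -opprB rpredN. Qed.

Lemma linked_double s t : linked s t -> double_point (curve D) s t.
Proof. by case=> /over_double// /double_point_sym. Qed.

Lemma linked_unique s t u : linked s t -> linked s u ->
  exists n : int, u = t + n%:~R.
Proof.
move=> /linked_double st /linked_double su.
have /intrP[n e] := curve_double su st.
by exists n; rewrite -e addrC subrK.
Qed.

Lemma over_unders s t u : over D s t -> ~ over D u s.
Proof.
move=> st us; have [n e] := linked_unique (or_introl st) (or_intror us).
have := over_periodic (- n) 0 us; rewrite e mulrNz addrK addr0.
exact: over_asym.
Qed.

Lemma linked_partner s t : linked s t -> linked s (partner s).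
Proof. by move=> st; rewrite /Submission.partner; case: xgetP => [u _//|/(_ t)]. Qed.

Lemma endpoint_signE s t : linked s t ->
  endpoint_sign s = sgz (det2 (velocity t) (velocity s)).
Proof.
move=> st; have [n ->] := linked_unique (linked_partner st) st.
by rewrite endpoint_sign.unlock velocity_periodicz.
Qed.

Lemma endpoint_sign_unlinked s : (forall t, ~ linked s t) -> endpoint_sign s = 0.
Proof.
move=> sn; rewrite endpoint_sign.unlock /Submission.partner; case: xgetP => [u _ /sn//|_].
by rewrite /det2 mulrC subrr sgz0.
Qed.

Lemma endpoint_sign_linked s : endpoint_sign s != 0 -> linked s (partner s).
Proof.
move=> s0; have [[t /linked_partner//]|sn] := pselect (exists t, linked s t).
rewrite endpoint_sign_unlinked ?eqxx// in s0.
by move=> t st; apply: sn; exists t.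
Qed.

Lemma endpoint_signC s t : linked s t -> endpoint_sign t = - endpoint_sign s.
Proof.
move=> st; rewrite (endpoint_signE st) (endpoint_signE (linked_sym st)).
by rewrite det2C sgzN.
Qed.

Lemma endpoint_sign_periodic : periodic1 endpoint_sign.
Proof.
move=> s; have [[t st]|sn] := pselect (exists t, linked s t).
  have st1 : linked (s + 1) t by have := linkedz 1 0 st; rewrite addr0.
  by rewrite (endpoint_signE st) (endpoint_signE st1) (velocity_periodicz s 1).
rewrite !endpoint_sign_unlinked// => t st; apply: sn; exists t => //.
by have := linkedz (-1) 0 st; rewrite mulrNz addrK addr0.
Qed.

Lemma endpoint_sign_lf : locally_finite endpoint_sign.
Proof.
apply: locally_finite_periodic endpoint_sign_periodic _.
apply: sub_finite_set (curve_finite D) => s [s01 /endpoint_sign_linked sp].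
by split=> //; exists (partner s); exact: linked_double.
Qed.

(** Passing to the other endpoint of the chord, brought back to [0, 1[ by its fractional part, is an
    involution that negates the signs. The sum is therefore its own opposite. *)
Lemma endpoint_sign_total : isum endpoint_sign 0 1 = 0.
Proof.
pose S := [set s | 0 <= s < 1 /\ exists t, linked s t].
pose fr x : R := x - (Num.floor x)%:~R.
have fr01 x : 0 <= fr x < 1.
  have /andP[] := floor_itv x; rewrite intrD1 /fr => h1 h2.
  by apply/andP; split; lra.
have fr_eq x (n : int) : 0 <= x + n%:~R < 1 -> x + n%:~R = fr x.
  move=> xn; rewrite /fr; congr (_ + _); rewrite -mulrNz; congr (_%:~R).
  have -> : Num.floor x = - n; last by rewrite opprK.
  apply: floor_def; rewrite intrD1 mulrNz; case/andP: xn => h1 h2.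
  by apply/andP; split; lra.
have frE x : exists n : int, fr x = x + n%:~R.
  by exists (- Num.floor x); rewrite mulrNz.
have isumS : isum endpoint_sign 0 1 = \sum_(s \in S) endpoint_sign s.
  rewrite isumE; apply/esym/fsbig_widen; first by move=> s [].
  move=> s /= [s01 sS]; apply: endpoint_sign_unlinked => t st.
  by apply: sS; split=> //; exists t.
pose tau s := fr (partner s).
have tauS s : S s -> S (tau s) /\ linked s (tau s).
  move=> [s01 [t /linked_partner st]].
  have l : linked s (tau s).
    by rewrite /tau; have [n ->] := frE (partner s); 
       have := linkedz 0 n st; rewrite addr0.
  by split=> //; split; [exact: fr01|exists s; exact: linked_sym].
have tauK s : S s -> tau (tau s) = s.
  move=> sS; have [tS l] := tauS _ sS; have [_ l'] := tauS _ tS.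
  have [n e] := linked_unique (linked_sym l) l'.
  rewrite e; have := fr01 (partner (tau s)); rewrite -/(tau (tau s)) e => h.
  have [/andP[h1 h2] _] := sS; case/andP: h => h3 h4.
  have -> : n = 0; last by rewrite addr0.
  have n1 : n < 1 by rewrite -(ltr_int R); lra.
  have n0 : - 1 < n by rewrite -(ltr_int R) mulrNz; lra.
  by apply/eqP; rewrite eq_le -ltzD1 add0r n1 -ltzD1 -ltrBlDr sub0r.
have : isum endpoint_sign 0 1 = - isum endpoint_sign 0 1.
  rewrite {1}isumS (@reindex_fsbig _ _ _ _ _ tau S S).
    rewrite -isumN isumE.
    rewrite [RHS](_ : _ = \sum_(s \in S) - endpoint_sign s).
      by apply: eq_fsbigr => s; rewrite inE => /tauS[_ /endpoint_signC].
    apply/esym/fsbig_widen; first by move=> s [].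
    move=> s /= [s01 sS]; rewrite endpoint_sign_unlinked ?oppr0// => t st.
    by apply: sS; split=> //; exists t.
  split=> [s /tauS[]//|s t|s sS].
    by rewrite !inE => sS tS e; rewrite -(tauK s)// e tauK.
  by exists (tau s); [case: (tauS s sS)|exact: tauK].
by move/eqP; rewrite -addr_eq0 -mulr2n mulrn_eq0 => /eqP.
Qed.
End EndpointSigns.

HB.lock Definition sign_sum (R : realType) (D : diagram R) : R -> int :=
  prim (endpoint_sign D).

(** * Indices and writhes as interval sums *)

Section ChordIndices.
Variables (R : realType) (D : diagram R).
Implicit Types s t u : R.

Local Notation velocity := (derive1 (curve D)).
Local Notation sg := (endpoint_sign D).
Local Notation sign_sum := (sign_sum D).

Lemma sign_sumE : sign_sum = prim sg.
Proof. by rewrite sign_sum.unlock. Qed.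

Lemma sign_sum_periodicz s (n : int) : sign_sum (s + n%:~R) = sign_sum s.
Proof.
rewrite sign_sumE.
apply: prim_periodz; [exact: endpoint_sign_lf|exact: endpoint_sign_periodic|].
exact: endpoint_sign_total.
Qed.

Lemma sign_sumB s t : s <= t -> sign_sum t - sign_sum s = isum sg s t.
Proof. by move=> st; rewrite sign_sumE primB//; exact: endpoint_sign_lf. Qed.

Definition is_over s : bool := `[< exists t, over D s t >].

(** Meant for the initial endpoint of a chord. As [sign_sum] is periodic, it does not matter which
    translate of the terminal endpoint [partner] returns. *)
Definition over_index s : int := sign_sum (partner D s) - sign_sum s - sg s.

(** Each chord is charged to its initial endpoint, whose sign is opposite to that of the chord. As a
    density on the circle, a writhe can be localized by the same lemmas on strands as an index. *)
Definition writhe_density (n : int) s : int :=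
  if is_over s && (over_index s == n) then - sg s else 0.

Lemma over_linked s t : over D s t -> linked D s t.
Proof. by left. Qed.

Lemma over_indexE s t : linked D s t ->
  over_index s = sign_sum t - sign_sum s - sg s.
Proof.
move=> st; have [n ->] := linked_unique (linked_partner st) st.
by rewrite sign_sum_periodicz.
Qed.

Lemma is_over_periodic s : is_over (s + 1) = is_over s.
Proof.
rewrite /is_over; apply: asbool_equiv_eq; split=> -[t st]; exists t.
  by have := over_periodic (-1) 0 st; rewrite mulrNz addrK addr0.
by have := over_periodic 1 0 st; rewrite addr0.
Qed.

Lemma writhe_density_periodic n : periodic1 (writhe_density n).
Proof.
move=> s; rewrite /writhe_density is_over_periodic /is_over.
have [[t st']|no] := pselect (exists t, over D s t); last first.
  by rewrite (asboolF no) /=.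
have st := over_linked st'; have ex : exists t, over D s t by exists t.
rewrite (asboolT ex) /=.
have st1 : linked D (s + 1) t by have := linkedz 1 0 st; rewrite addr0.
rewrite (over_indexE st) (over_indexE st1) endpoint_sign_periodic.
by rewrite (sign_sum_periodicz s 1).
Qed.

Lemma writhe_density_lf n : locally_finite (writhe_density n).
Proof.
apply: locally_finite_sub (endpoint_sign_lf D) => s.
by rewrite /writhe_density; case: ifP; rewrite ?oppr_eq0 ?eqxx.
Qed.

Lemma chord_sign_initial (c : R * R) : over D c.1 c.2 ->
  chord_sign D c = - sg c.1.
Proof.
by move=> /over_linked st; rewrite (endpoint_signE st) det2C sgzN opprK.
Qed.

Lemma chord_sign_terminal (c : R * R) : over D c.1 c.2 ->
  chord_sign D c = sg c.2.
Proof. by move=> st; rewrite (endpoint_signE (or_intror st)). Qed.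

(** This is the lift of t that the definition of [chords] asks for; the lower bound is strict
    because s - t is not an integer. *)
Let near s t : (s - t \isn't a Num.int) ->
  exists2 n : int, s < t + n%:~R < s + 1 &
    forall m : int, s < t + m%:~R < s + 1 -> m = n.
Proof.
move=> st; have [n /andP[n0 n1]] := floor_shift (t - s).
have ns : s < t + n%:~R < s + 1.
  apply/andP; split; last by lra.
  rewrite lt_neqAle; apply/andP; split; last by lra.
  apply: contra st => /eqP st; apply/intrP; exists n.
  by rewrite {1}st addrC addKr.
exists n => // m /andP[m0 m1]; case/andP: ns => h0 h1.
have : m < n + 1 by rewrite -(ltr_int R) rmorphD/=; lra.
have : n < m + 1 by rewrite -(ltr_int R) rmorphD/=; lra.
by rewrite !ltzD1 => *; apply/eqP; rewrite eq_le; apply/andP.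
Qed.

Lemma chord_from s : is_over s -> exists c, chords D c /\ c.1 = s.
Proof.
move=> /asboolP[t st]; have [_ ne] := over_double st.
have [n nP _] := near ne; exists (s, t + n%:~R); split=> //.
by split=> //=; have := over_periodic 0 n st; rewrite addr0.
Qed.

Lemma chord_to t s : over D s t -> exists c, chords D c /\ c.2 = t.
Proof.
move=> st; have [_ ne] := double_point_sym (over_double st).
(* [near] lifts s into ]t, t + 1[, whereas the initial parameter of a chord ending at t lies in ]t -
   1, t[. *)
have [n /andP[n0 n1] _] := near ne; exists (s + (n - 1)%:~R, t).
split=> //; split=> /=; first by have := over_periodic (n - 1) 0 st; rewrite addr0.
by rewrite rmorphB/=; apply/andP; split; lra.
Qed.

Lemma chord_inj1 (c d : R * R) : chords D c -> chords D d -> c.1 = d.1 -> c = d.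
Proof.
case: c d => [s t] [s' u] [/= st stt] [/= su suu] e; move: e su suu => <- su suu.
have [_ ne] := over_double st; have [n _ nu] := near ne.
have [m e] := linked_unique (over_linked st) (over_linked su).
have e0 : 0 = n by apply: nu; rewrite addr0.
have em : m = n by apply: nu; rewrite -e.
by rewrite e em -e0 addr0.
Qed.

Lemma chord_inj2 (c d : R * R) : chords D c -> chords D d -> c.2 = d.2 -> c = d.
Proof.
case: c d => [s t] [s' u] [/= st /andP[s1 s2]] [/= su /andP[s3 s4]] e.
move: e su s3 s4 => <- su s3 s4.
have [_ ne] := double_point_sym (over_double st); have [n _ nu] := near ne.
have [m e] := linked_unique (or_intror st) (or_intror su).
rewrite e in s3 s4 *; congr pair.
have : 1 = n by apply: nu; apply/andP; split; lra.
have : m + 1 = n by apply: nu; rewrite rmorphD/=; apply/andP; split; lra.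
by move=> <- /eqP; rewrite eq_sym -subr_eq0 addrK => /eqP ->; rewrite addr0.
Qed.

(** An endpoint on the open arc occurs in exactly one of the two sums of [chord_index], since no
    parameter is both over and under, and it contributes its endpoint sign. The half-open interval
    also contains c.1, whence the last term of [over_index]. *)
Lemma chord_index_sign_sum (c : R * R) : chords D c ->
  chord_index D c = over_index c.1.
Proof.
move=> [st /andP[c12 c21]]; rewrite (over_indexE (over_linked st)).
rewrite (sign_sumB (ltW c12)).
pose Qo s := (c.1 < s) && is_over s.
pose Qu s := (c.1 < s) && `[< exists t, over D t s >].
have -> : chord_index D c = isum (fun z => if Qo z then sg z else 0) c.1 c.2 +
    isum (fun z => if Qu z then sg z else 0) c.1 c.2.
  rewrite /chord_index -!isum_cond; congr (_ + _).
    apply/esym; rewrite (@reindex_fsbig _ _ _ _ _ fst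
      [set d | chords D d /\ c.1 < d.1 < c.2]).
      apply: eq_fsbigr => d; rewrite inE => -[[od _] _].
      by rewrite chord_sign_initial// opprK.
    split=> [d /= [[od _] /andP[d1 d2]]|d d'|s /= [/andP[_ s2] /andP[s1 so]]].
    - by rewrite (ltW d1) d2 /Qo d1/=; split=> //; apply/asboolP; exists d.2.
    - by rewrite !inE => -[cd _] [cd' _]; exact: chord_inj1.
    - have [d [cd ds]] := chord_from so; exists d => //.
      by split=> //; rewrite ds s1.
  apply/esym; rewrite (@reindex_fsbig _ _ _ _ _ snd
    [set d | chords D d /\ c.1 < d.2 < c.2]).
    apply: eq_fsbigr => d; rewrite inE => -[[od _] _].
    by rewrite chord_sign_terminal.
  split=> [d /= [[od _] /andP[d1 d2]]|d d'|s /= [/andP[_ s2] /andP[s1 so]]].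
  - by rewrite (ltW d1) d2 /Qu d1/=; split=> //; apply/asboolP; exists d.1.
  - by rewrite !inE => -[cd _] [cd' _]; exact: chord_inj2.
  - have [t /chord_to[d [cd ds]]] := asboolP _ so; exists d => //.
    by split=> //; rewrite ds s1.
have sub (Q : pred R) : locally_finite (fun z => if Q z then sg z else 0).
  apply: locally_finite_sub (endpoint_sign_lf D) => s.
  by case: ifP; rewrite ?eqxx.
(* The term at c.1 is itself written as an interval sum, so that the identity can be checked
   pointwise. *)
have d1E : isum (fun z => if z == c.1 then sg z else 0) c.1 c.2 = sg c.1.
  rewrite (@isum_fin _ _ _ _ unit (fun=> c.1) xpredT).
  - by rewrite big_const card_unit /= eqxx addr0.
  - by move=> [] [].
  - by move=> _ _; rewrite lexx.
  - by move=> t _; case: (eqVneq t c.1) => [-> _|_]; [exists tt|rewrite eqxx].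
apply/esym/eqP; rewrite subr_eq -d1E; apply/eqP.
rewrite -isum_add; last 2 first.
- exact: (sub Qo).
- exact: (sub Qu).
rewrite -isum_add; last 2 first.
- apply: locally_finite_sub (endpoint_sign_lf D) => s.
  by apply: contraNN => /eqP s0; rewrite s0 !if_same addr0.
- exact: (sub (fun z => z == c.1)).
clear d1E; apply: eq_isum => z /andP[]; rewrite le_eqVlt /Qo /Qu => /orP[/eqP <- _|cz zc].
  by rewrite ltxx eqxx !add0r.
rewrite cz (gt_eqF cz) /= addr0 /is_over.
have [eo|no] := pselect (exists t, over D z t).
  have nu : ~ exists u, over D u z.
    by move=> [u uz]; have [t zt] := eo; exact: (over_unders zt uz).
  by rewrite (asboolT eo) (asboolF nu) /= addr0.
rewrite (asboolF no) /= add0r.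
have [eu|nu] := pselect (exists t, over D t z); first by rewrite (asboolT eu).
rewrite (asboolF nu) /= endpoint_sign_unlinked// => t [zt|tz].
  by apply: no; exists t.
by apply: nu; exists t.
Qed.

Lemma diagram_writheE n : diagram_writhe D n = isum (writhe_density n) 0 1.
Proof.
rewrite /diagram_writhe -(isum_cond (fun s => - sg s)).
apply/esym; rewrite (@reindex_fsbig _ _ _ _ _ fst
  [set c | [/\ chords D c, 0 <= c.1 < 1 & chord_index D c = n]]).
  apply: eq_fsbigr => c; rewrite inE => -[[oc _] _ _].
  by rewrite chord_sign_initial.
split=> [c /= [cc c01 ci]|c d|s /= [s01 /andP[so si]]].
- split=> //; rewrite -chord_index_sign_sum// ci eqxx andbT.
  by apply/asboolP; exists c.2; case: cc.
- by rewrite !inE => -[cc _ _] [cd _ _]; exact: chord_inj1.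
- have [c [cc cs]] := chord_from so; exists c => //; split=> //.
    by rewrite cs.
  by rewrite chord_index_sign_sum// cs; exact/eqP.
Qed.

End ChordIndices.

(** * Invariance of the writhes under reparametrization of the circle *)

Section Reparametrization.
Variables (R : realType) (D D' : diagram R) (r : R -> R).
Hypothesis r1 : forall s, r (s + 1) = r s + 1.
Hypothesis r_mono : {mono r : s t / s <= t}.
Hypothesis r_surj : forall t, exists s, r s = t.
Hypothesis r_over : forall s t, over D' s t <-> over D (r s) (r t).

Definition preserves_signs : Prop := forall s t, over D' s t ->
  sgz (det2 (derive1 (curve D') s) (derive1 (curve D') t)) =
  sgz (det2 (derive1 (curve D) (r s)) (derive1 (curve D) (r t))).

Hypothesis r_sign : preserves_signs.

Let isum_r (h : R -> int) x y : isum (fun s => h (r s)) x y = isum h (r x) (r y).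
Proof. exact: isum_reparam. Qed.

Let linked_r s t : linked D' s t <-> linked D (r s) (r t).
Proof.
by split=> -[] /r_over; [left|right|left|right].
Qed.

Let endpoint_sign_r s : endpoint_sign D' s = endpoint_sign D (r s).
Proof.
have [[t st]|no] := pselect (exists t, linked D' s t).
  rewrite (endpoint_signE st) (endpoint_signE (proj1 (linked_r s t) st)).
  case: st => [st|ts]; last exact (r_sign ts).
  exact (etrans (sgz_det2C _ _)
    (etrans (congr1 -%R (r_sign st)) (esym (sgz_det2C _ _)))).
rewrite !endpoint_sign_unlinked// => t st; last by apply: no; exists t.
apply: no; have [u ut] := r_surj t; exists u.
by apply/linked_r; rewrite ut.
Qed.

Let sign_sum_r s t :
  sign_sum D' t - sign_sum D' s = sign_sum D (r t) - sign_sum D (r s).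
Proof.
wlog st : s t / s <= t => [wh|].
  have [/wh//|/ltW/wh e] := leP s t.
  exact (etrans (esym (opprB _ _)) (etrans (congr1 -%R e) (opprB _ _))).
have rst : r s <= r t by rewrite r_mono.
rewrite (sign_sumB D' st).
rewrite (sign_sumB D rst).
rewrite -isum_r.

by apply: eq_isum => z _; exact: endpoint_sign_r.
Qed.

Let writhe_density_r n s : writhe_density D' n s = writhe_density D n (r s).
Proof.
rewrite /writhe_density /is_over.
have [[t st]|no] := pselect (exists t, over D' s t); last first.
  rewrite (asboolF no) asboolF // => -[t st]; apply: no.
  by have [u ut] := r_surj t; exists u; apply/r_over; rewrite ut.
have e1 : exists t, over D' s t by exists t.
have e2 : exists t, over D (r s) t by exists (r t); apply/r_over.
rewrite (asboolT e1) (asboolT e2) /=.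
rewrite (over_indexE (over_linked st)).
rewrite (over_indexE (proj1 (linked_r s t) (over_linked st))).
by rewrite sign_sum_r endpoint_sign_r.
Qed.

Lemma diagram_writhe_reparam n : diagram_writhe D' n = diagram_writhe D n.
Proof.
rewrite !diagram_writheE (eq_isum (fun s _ => writhe_density_r n s)).
rewrite isum_r -{1}[1]add0r r1.
by apply: isum_period; [exact: writhe_density_lf|exact: writhe_density_periodic].
Qed.

End Reparametrization.

(** * Planar isotopies *)

Section PlaneCalculus.
Variable R : realType.

Lemma planeZ (a : R) (u : plane R) : a *: u = (a * u.1, a * u.2).
Proof. by []. Qed.

Lemma planeD (u v : plane R) : u + v = (u.1 + v.1, u.2 + v.2).
Proof. by []. Qed.

Definition jacobian2 (f : plane R -> plane R) (p : plane R) : R :=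
  det2 (tangent_map f p (1, 0)) (tangent_map f p (0, 1)).

Lemma det2_tangent_map (f : plane R -> plane R) (p u v : plane R) :
  det2 (tangent_map f p u) (tangent_map f p v) = jacobian2 f p * det2 u v.
Proof.
have lin (w : plane R) : tangent_map f p w =
    w.1 *: tangent_map f p (1, 0) + w.2 *: tangent_map f p (0, 1).
  rewrite /tangent_map -!linearZ -linearD; congr ('d f p _).
  by rewrite !planeZ planeD /=; case: w => x y; congr pair => /=; ring.
by rewrite (lin u) (lin v) /jacobian2 /det2 !planeZ !planeD /=; ring.
Qed.

Lemma derivable_curve_comp (f : plane R -> plane R) (c : R -> plane R)
    (r : R -> R) (s : R) :
  differentiable f (c (r s)) -> derivable c (r s) 1 -> derivable r s 1 ->
  derivable (fun s => f (c (r s))) s 1 /\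
  derive1 (fun s => f (c (r s))) s =
    derive1 r s *: tangent_map f (c (r s)) (derive1 c (r s)).
Proof.
move=> df /derivable1_diffP dc /derivable1_diffP dr.
have dcr : differentiable (c \o r) s by exact: differentiable_comp.
have dfcr : differentiable (f \o (c \o r)) s by exact: differentiable_comp.
split; first exact/derivable1_diffP.
rewrite (derive1E' dfcr) /tangent_map.
have e1 := congr1 (fun h => h 1) (diff_comp dcr df).
have e2 := congr1 (fun h => h 1) (diff_comp dr dc).
rewrite (derive1E' dc) (derive1E' dr).
have lin (x : R) : 'd c (r s) x = x *: 'd c (r s) 1.
  by rewrite -linearZ; congr ('d c _ _); rewrite /GRing.scale /= mulr1.
apply: etrans e1 _; apply: (etrans (congr1 ('d f (c (r s))) e2)).
exact (etrans (congr1 ('d f (c (r s))) (lin ('d r s 1))) (linearZ _ _)).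
Qed.

Lemma derive1_gt0_lt (r : R -> R) (x y : R) : x < y ->
    (forall s, x <= s <= y -> derivable r s 1 /\ 0 < derive1 r s) ->
  r x < r y.
Proof.
move=> xy h; apply: (@gtr0_derive1_incr _ r x y) => //.
- by move=> s /[!in_itv]/= /andP[/ltW xs /ltW sy]; apply: (h s _).1; rewrite xs.
- by move=> s /[!in_itv]/= /andP[/ltW xs /ltW sy]; apply: (h s _).2; rewrite xs.
- by apply: derivable_within_continuous => s; rewrite in_itv => /h[].
Qed.

Lemma diff_id (p : plane R) : 'd id p = id :> (plane R -> plane R).
Proof. exact: diff_val. Qed.

(** By the chain rule, the Jacobians of f and of its inverse multiply to 1. *)
Lemma jacobian2_diffeo (f : plane R -> plane R) (p : plane R) : diffeo f ->
  jacobian2 f p != 0.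
Proof.
move=> [[df _] [g [[dg _] fK gK]]]; apply/eqP => j0.
have chain : 'd g (f p) \o 'd f p = id :> (plane R -> plane R).
  rewrite -(diff_comp (df p) (dg (f p))) (_ : g \o f = id).
    exact: diff_id.
  by apply/funext => q /=; rewrite fK.
have tan v : tangent_map g (f p) (tangent_map f p v) = v.
  by have := congr1 (fun h => h v) chain.
have := det2_tangent_map g (f p) (tangent_map f p (1, 0)) (tangent_map f p (0, 1)).
rewrite !tan -/(jacobian2 f p) j0 mulr0 /det2 /= mulr0 mulr1 subr0.
by move/eqP; rewrite oner_eq0.
Qed.

Lemma sgz_det2_move (f : plane R -> plane R) (p u v : plane R) (x y : R) :
  0 < jacobian2 f p -> 0 < x -> 0 < y ->
  sgz (det2 (x *: tangent_map f p u) (y *: tangent_map f p v)) = sgz (det2 u v).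
Proof.
move=> j0 x0 y0.
have -> : det2 (x *: tangent_map f p u) (y *: tangent_map f p v) =
    (x * y * jacobian2 f p) * det2 u v.
  by rewrite -mulrA -det2_tangent_map /det2 !planeZ /=; ring.
by rewrite sgzM gtr0_sgz ?mul1r// !mulr_gt0.
Qed.

End PlaneCalculus.

Section Isotopy.
Variable R : realType.

(** Along the isotopy the Jacobian at p is continuous in time, never 0, and equal to 1 at time 0; by
    the intermediate value theorem it cannot have become negative at time 1. *)
Lemma isotopy_jacobian2 (H : R -> plane R -> plane R) (p : plane R) :
  isotopy H -> 0 < jacobian2 (H 1) p.
Proof.
move=> [dH _ cH H0].
have cj : continuous (fun t => jacobian2 (H t) p).
  have cv v : continuous (fun t => tangent_map (H t) p v).
    move=> t; apply: (@continuous_comp _ _ _ (fun t => (t, p))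
      (fun tp : R * plane R => tangent_map (H tp.1) tp.2 v)); last exact: cH.
    have ci : {for t, continuous (fun t : R => t)} by exact: cvg_id.
    have cp : {for t, continuous (fun _ : R => p)} by exact: cvg_cst.
    exact: (cvg_pair ci cp).
  move=> t; rewrite /jacobian2 /det2.
  have c1 v : {for t, continuous (fun t => (tangent_map (H t) p v).1)}.
    apply: (@continuous_comp _ _ _ (fun t => tangent_map (H t) p v) fst).
      exact: cv.
    exact: cvg_fst.
  have c2 v : {for t, continuous (fun t => (tangent_map (H t) p v).2)}.
    apply: (@continuous_comp _ _ _ (fun t => tangent_map (H t) p v) snd).
      exact: cv.
    exact: cvg_snd.
  by apply: cvgB; apply: cvgM; [exact: c1|exact: c2|exact: c2|exact: c1].
have j0 : jacobian2 (H 0) p = 1.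
  rewrite /jacobian2 /tangent_map (_ : H 0 = id); last exact/funext.
  rewrite diff_id.
  by rewrite /det2 /= mulr0 mulr1 subr0.
rewrite ltNge le_eqVlt (negbTE (jacobian2_diffeo _ (dH 1)))/=.
apply/negP => j1.
have [||t _ jt] := @IVT R (fun t => jacobian2 (H t) p) 0 1 0 ler01.
- exact: continuous_subspaceT.
- by rewrite j0 ge_min le_max ler01 (ltW j1) orbT.
by have := jacobian2_diffeo p (dH t); rewrite jt eqxx.
Qed.

Lemma circle_reparam_mono (r : R -> R) : circle_reparam r ->
  {mono r : s t / s <= t}.
Proof.
move=> [_ dr _ r0]; apply: le_mono => x y xy.
by apply: derive1_gt0_lt.
Qed.

Lemma circle_reparam_surj (r : R -> R) : circle_reparam r ->
  forall t, exists s, r s = t.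
Proof.
move=> cr t; have mono := circle_reparam_mono cr.
case: cr => r1 dr _ _.
have rz s (n : int) : r (s + n%:~R) = r s + n%:~R.
  have per : periodic1 (fun s => r s - s) by move=> u; rewrite r1; ring.
  by have /eqP := periodicz n s per; rewrite subr_eq => /eqP ->; ring.
have [n /andP[n0 n1]] := floor_shift (t - r 0).
have [||s _ e] := @IVT R r 0 1 (t + n%:~R) ler01.
- by apply: derivable_within_continuous => s _; exact: dr.
- have := r1 0; rewrite add0r => ->.
  rewrite ge_min le_max; apply/andP; split; apply/orP; [left|right]; lra.
exists (s + (- n)%:~R); rewrite rz e mulrNz.
by rewrite addrK.
Qed.

Lemma planar_isotopic_writhe (D D' : diagram R) (n : int) :
  planar_isotopic D D' -> diagram_writhe D' n = diagram_writhe D n.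
Proof.
move=> [H [r [iH cr cE oE]]].
apply: (@diagram_writhe_reparam _ D D' r).
- by case: cr.
- exact: circle_reparam_mono.
- exact: circle_reparam_surj.
- exact: oE.
move=> s t st.
have [ce _] := over_double ((oE s t).1 st).
have [_ dr _ r0] := cr.
have fE : curve D' = fun s => H 1 (curve D (r s)) by exact/funext.
have dE u : derive1 (curve D') u = derive1 r u *:
    tangent_map (H 1) (curve D (r u)) (derive1 (curve D) (r u)).
  rewrite fE; apply: (derivable_curve_comp _ _ _).2 => //.
  - by have [dH _ _ _] := iH; have [[]] := dH 1.
  - exact: curve_derivable.
rewrite !dE -ce; apply: sgz_det2_move => //.
exact: isotopy_jacobian2.
Qed.
End Isotopy.

(** * Local moves *)

(** A finite table of the crossings of a model. Virtual crossings may be listed too, as pairs of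
    mates neither of which is [upper], so that one table of points serves for every choice of
    crossing types. By [chord_exhaust] no real crossing is missing. *)
Record tangle_chords (R : realType) k (T : tangle R k) := TangleChords {
  endpoint : finType;
  strand_of : endpoint -> 'I_k;
  param : endpoint -> R;
  mate : endpoint -> endpoint;
  upper : pred endpoint;
  local_sign : endpoint -> int;
  param_itv : forall p, -1 < param p < 1;
  endpoint_inj : forall p q,
    strand_of p = strand_of q -> param p = param q -> p = q;
  mateK : involutive mate;
  upper_mate : forall p, upper p -> ~~ upper (mate p);
  chord_double : forall p, upper p ->
    strand T (strand_of p) (param p) = strand T (strand_of (mate p)) (param (mate p));
  chord_over : forall p, upper p ->
    tover T (strand_of p) (param p) (strand_of (mate p)) (param (mate p));
  chord_sign_mate : forall p, upper p || upper (mate p) ->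
    sgz (det2 (derive1 (strand T (strand_of (mate p))) (param (mate p)))
              (derive1 (strand T (strand_of p)) (param p))) = local_sign p;
  chord_exhaust : forall i u j v, -1 < u < 1 -> -1 < v < 1 ->
    strand T i u = strand T j v -> i != j \/ u != v -> tover T i u j v ->
    exists p, [/\ upper p, strand_of p = i, param p = u,
      strand_of (mate p) = j & param (mate p) = v]
}.

Section TangleInvariants.
Variables (R : realType) (k : nat) (T : tangle R k) (C : tangle_chords T).
Implicit Types p q : endpoint C.

Definition real_endpoint p : bool := upper p || upper (mate p).

Definition tangle_sign p : int := if real_endpoint p then local_sign p else 0.

Definition strand_total (i : 'I_k) : int :=
  \sum_(p | strand_of p == i) tangle_sign p.

Definition sign_before p : int :=
  \sum_(q | (strand_of q == strand_of p) && (param q < param p)) tangle_sign q.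

(* [g i] stands for the sum of the endpoint signs at the entrance of strand i *)
Definition tangle_index (g : 'I_k -> int) p : int :=
  (g (strand_of (mate p)) + sign_before (mate p)) -
  (g (strand_of p) + sign_before p) - tangle_sign p.

Definition tangle_writhe (g : 'I_k -> int) (n : int) : int :=
  \sum_(p | upper p && (tangle_index g p == n)) - tangle_sign p.

(** Only differences between entrances matter. The functions G of the two diagrams of a move are
    compared outside of the disk only up to a constant, which is thereby harmless. *)
Lemma tangle_index_shift g (c : int) p :
  tangle_index (fun i => g i + c) p = tangle_index g p.
Proof. by rewrite /tangle_index; ring. Qed.

Lemma tangle_writhe_shift g (c : int) n :
  tangle_writhe (fun i => g i + c) n = tangle_writhe g n.
Proof. by apply: eq_bigl => p; rewrite tangle_index_shift. Qed.

End TangleInvariants.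

(** * A diagram read in the chart of a disk *)

Section Chart.
Variables (R : realType) (D : diagram R) (f : plane R -> plane R) (k : nat).
Variables (T : tangle R k) (a b : 'I_k -> R) (r : 'I_k -> R -> R).
Hypothesis f_diffeo : diffeo f.
Hypothesis f_orient : orientation_preserving f.
Hypothesis T_derivable : forall i u, derivable (strand T i) u 1.
Hypothesis disk_inside : forall s, (f @` @unit_disk R) (curve D s) <->
  exists i (n : int), a i < s + n%:~R < b i.
Hypothesis disk_disjoint : forall i j s (n : int),
  a i < s < b i -> a j < s + n%:~R < b j -> i = j /\ n = 0.
Hypothesis r_derivable : forall i s, a i < s < b i ->
  derivable (r i) s 1 /\ 0 < derive1 (r i) s.
Hypothesis r_image : forall i,
  r i @` [set s | a i < s < b i] = [set u | -1 < u < 1].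
Hypothesis curveE : forall i s, a i < s < b i -> curve D s = f (strand T i (r i s)).
Hypothesis overE : forall i j s t, a i < s < b i -> a j < t < b j ->
  double_point (curve D) s t -> (over D s t <-> tover T i (r i s) j (r j t)).

Lemma chart_disjoint : disjoint_strands a b.
Proof.
split=> [i|]; last exact: disk_disjoint.
have : [set u : R | -1 < u < 1] 0 by rewrite /= ltrN10 ltr01.
by rewrite -(r_image i) => -[s /= /andP[as_ sb] _]; exact: lt_trans sb.
Qed.

Lemma curve_inside s : (f @` @unit_disk R) (curve D s) <-> inside a b s.
Proof. exact: disk_inside. Qed.

Lemma chart_range i s : a i < s < b i -> -1 < r i s < 1.
Proof.
move=> si; suff : [set u : R | -1 < u < 1] (r i s) by [].
by rewrite -(r_image i); exists s.
Qed.

Lemma chart_lt i s t : a i < s < b i -> a i < t < b i ->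
  (r i s < r i t) = (s < t).
Proof.
have lt_r x y : a i < x < b i -> a i < y < b i -> x < y -> r i x < r i y.
  move=> /andP[ax xb] /andP[ay yb] xy; apply: derive1_gt0_lt => // z /andP[xz zy].
  by apply: r_derivable; rewrite (lt_le_trans ax xz) (le_lt_trans zy yb).
move=> si ti; case: (ltgtP s t) => [st|ts|->]; last by rewrite ltxx.
  exact: lt_r.
by apply/negbTE; rewrite -leNgt ltW//; exact: lt_r.
Qed.

Lemma chart_inj i s t : a i < s < b i -> a i < t < b i ->
  r i s = r i t -> s = t.
Proof.
move=> si ti e; have := chart_lt si ti; have := chart_lt ti si.
by rewrite e ltxx; case: ltgtP.
Qed.

Let pos_ex i (u : R) : exists s, -1 < u < 1 -> a i < s < b i /\ r i s = u.
Proof.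
have [u1|u1] := boolP (-1 < u < 1); last by exists 0.
have : [set u : R | -1 < u < 1] u by [].
by rewrite -(r_image i) => -[s si e]; exists s.
Qed.

Definition chart_inv i u : R := projT1 (cid (pos_ex i u)).

Lemma chart_invP i u : -1 < u < 1 ->
  a i < chart_inv i u < b i /\ r i (chart_inv i u) = u.
Proof. by rewrite /chart_inv; case: cid. Qed.

Lemma chart_invK i s : a i < s < b i -> chart_inv i (r i s) = s.
Proof.
move=> si; have [zi e] := chart_invP i (chart_range si).
exact: chart_inj zi si e.
Qed.

Lemma chart_velocity i s : a i < s < b i ->
  derive1 (curve D) s = derive1 (r i) s *:
    tangent_map f (strand T i (r i s)) (derive1 (strand T i) (r i s)).
Proof.
move=> si; have [[df _] _] := f_diffeo; have [dr _] := r_derivable si.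
have [dc <-] := derivable_curve_comp (df _) (@T_derivable i (r i s)) dr.
rewrite !derive1E; apply: near_eq_derive.
have : s \in `]a i, b i[ by rewrite in_itv.
move=> /near_in_itvoo; apply: filterS => x; rewrite in_itv; exact: curveE.
Qed.

Lemma chart_crossing_sign i j s t : a i < s < b i -> a j < t < b j ->
    strand T i (r i s) = strand T j (r j t) ->
  sgz (det2 (derive1 (curve D) s) (derive1 (curve D) t)) =
  sgz (det2 (derive1 (strand T i) (r i s)) (derive1 (strand T j) (r j t))).
Proof.
move=> si tj e; rewrite (chart_velocity si) (chart_velocity tj) e.
have [_ r0] := r_derivable si; have [_ r0'] := r_derivable tj.
by apply: sgz_det2_move => //; exact: f_orient.
Qed.

Lemma f_inj : injective f.
Proof. by have [_ [g [_ fK _]]] := f_diffeo; exact: can_inj fK. Qed.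

Let f_strand_continuous i (u : R) : {for u, continuous (fun u => f (strand T i u))}.
Proof.
apply: (@continuous_comp _ _ _ (strand T i) f).
  by apply/differentiable_continuous/derivable1_diffP; exact: T_derivable.
by apply: differentiable_continuous; have [[df _] _] := f_diffeo.
Qed.

Let curve_continuous (s : R) : {for s, continuous (curve D)}.
Proof.
by apply/differentiable_continuous/derivable1_diffP; exact: curve_derivable.
Qed.

(** Nothing is assumed on [r i] at [a i] itself. Being increasing from ]a i, b i[ onto ]-1, 1[, it
    tends to -1 there from the right, and both sides are continuous. *)
Lemma chart_start i : curve D (a i) = f (strand T i (-1)).
Proof.
have [ab _] := chart_disjoint.
have cr : r i s @[s --> (a i)^'+] --> (-1 : R).
  apply/cvgrPdist_lt => e e0; pose u := Num.min (-1 + e) 0.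
  have u1 : -1 < u < 1.
    by rewrite lt_min gt_min ltrN10 ltr01 orbT andbT ltrDl e0.
  have [zi zu] := chart_invP i u1.
  near=> s; have si : a i < s < b i by apply/andP; split.
  have /andP[r1 _] := chart_range si.
  rewrite ltr0_norm; last by rewrite subr_lt0.
  rewrite opprB opprK -ltrBrDr addrC; apply: (@lt_le_trans _ _ u).
    rewrite -zu (chart_lt si zi); near: s.
    by apply: nbhs_right_lt; case/andP: zi.
  by rewrite ge_min lexx.
have c1 := cvg_at_right_filter (@curve_continuous (a i)).
have c2 := cvg_comp _ _ cr (@f_strand_continuous i (-1)).
apply: (cvg_unique (@norm_hausdorff _ (plane R)) c1).
apply: cvg_trans c2; apply: near_eq_cvg; near=> s.
by rewrite /= -curveE//; apply/andP; split.
Unshelve. all: end_near. Qed.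

Lemma chart_end i : curve D (b i) = f (strand T i 1).
Proof.
have [ab _] := chart_disjoint.
have cr : r i s @[s --> (b i)^'-] --> (1 : R).
  apply/cvgrPdist_lt => e e0; pose u := Num.max (1 - e) 0.
  have u1 : -1 < u < 1.
    by rewrite lt_max gt_max ltrN10 ltr01 orbT andbT gtrBl e0.
  have [zi zu] := chart_invP i u1.
  near=> s; have si : a i < s < b i by apply/andP; split.
  have /andP[_ r1] := chart_range si.
  rewrite gtr0_norm; last by rewrite subr_gt0.
  rewrite ltrBlDr -ltrBlDl; apply: (@le_lt_trans _ _ u).
    by rewrite le_max lexx.
  rewrite -zu (chart_lt zi si); near: s.
  by apply: nbhs_left_gt; case/andP: zi.
have c1 := cvg_at_left_filter (@curve_continuous (b i)).
have c2 := cvg_comp _ _ cr (@f_strand_continuous i 1).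
apply: (cvg_unique (@norm_hausdorff _ (plane R)) c1).
apply: cvg_trans c2; apply: near_eq_cvg; near=> s.
by rewrite /= -curveE//; apply/andP; split.
Unshelve. all: end_near. Qed.

(** Excludes a parameter at which one strand ends and another begins: it would be isolated in the
    outside, and the agreement of two diagrams outside would not determine the velocity there. *)
Lemma chart_apart i j (n : int) :
  strand T i (-1) != strand T j 1 -> a i != b j + n%:~R.
Proof.
apply: contra => /eqP e; apply/eqP/f_inj.
by rewrite -chart_start -chart_end e curve_periodicz.
Qed.

Section Endpoints.
Variable C : tangle_chords T.
Implicit Types p q : endpoint C.

Definition endpoint_pos p : R := chart_inv (strand_of p) (param p).
Local Notation z := endpoint_pos.

Lemma endpoint_pos_itv p : a (strand_of p) < z p < b (strand_of p).
Proof. by case: (chart_invP (strand_of p) (param_itv p)). Qed.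

Lemma chart_endpoint_pos p : r (strand_of p) (z p) = param p.
Proof. by case: (chart_invP (strand_of p) (param_itv p)). Qed.

Lemma endpoint_posE p i s : strand_of p = i -> a i < s < b i -> param p = r i s ->
  z p = s.
Proof. by move=> <- si e; rewrite /endpoint_pos e chart_invK. Qed.

Lemma endpoint_pos_modz p q (n : int) : z p = z q + n%:~R -> p = q /\ n = 0.
Proof.
move=> e; have pi := endpoint_pos_itv p; have qi := endpoint_pos_itv q.
have qn : a (strand_of p) < z q + n%:~R < b (strand_of p) by rewrite -e.
have [est n0] := disk_disjoint qi qn; split=> //.
apply: endpoint_inj; first by rewrite est.
by rewrite -!chart_endpoint_pos e n0 addr0 est.
Qed.

Lemma endpoint_pos_inj : injective z.
Proof.
by move=> p q e; have [] := @endpoint_pos_modz p q 0; rewrite ?addr0.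
Qed.

(** Lying in the disk is a property of the point of the plane, so the other preimage of the crossing
    is inside as well, and the table of the model applies to both. *)
Lemma chart_over s t : inside a b s -> over D s t ->
  exists p (m n : int),
    [/\ upper p, z p = s + m%:~R & z (mate p) = t + n%:~R].
Proof.
move=> [i [m si]] st; have [e _] := over_double st.
have [j [n tj]] : inside a b t.
  by apply/curve_inside; rewrite -e; apply/curve_inside; exists i, m.
have st' := over_periodic m n st; have dp := over_double st'.
have eT : strand T i (r i (s + m%:~R)) = strand T j (r j (t + n%:~R)).
  by apply: f_inj; rewrite -!curveE//; case: dp.
(* On one strand, equal model parameters would make the two circle parameters equal modulo 1, which
   a double point excludes. *)
have ne : i != j \/ r i (s + m%:~R) != r j (t + n%:~R).
  have [eij|ne] := eqVneq i j; last by left.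
  right; apply/eqP => er; move: dp => -[_ /negP]; apply.
  rewrite -eij in er tj *; rewrite (chart_inj si tj er) subrr.
  exact: rpred0.
have [p [up pi pu pj pv]] :=
  chord_exhaust C (chart_range si) (chart_range tj) eT ne
    ((overE si tj dp).1 st').
exists p, m, n; split=> //; [exact: (endpoint_posE pi)|exact: (endpoint_posE pj)].
Qed.

Lemma upper_over p : upper p -> over D (z p) (z (mate p)).
Proof.
move=> up; have pi := endpoint_pos_itv p; have qi := endpoint_pos_itv (mate p).
apply/(overE pi qi); last by rewrite !chart_endpoint_pos; exact: chord_over.
split.
  by rewrite (curveE pi) (curveE qi) !chart_endpoint_pos chord_double.
apply/negP => /intrP[n e].
have [pm _] : p = mate p /\ n = 0.
  by apply: endpoint_pos_modz; rewrite -e addrC subrK.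
by have := upper_mate up; rewrite -pm up.
Qed.

Lemma real_linked p : real_endpoint p -> linked D (z p) (z (mate p)).
Proof.
move=> /orP[/upper_over|/upper_over]; first by left.
by rewrite mateK; right.
Qed.

Lemma over_upper p t : over D (z p) t -> upper p.
Proof.
have pin := inside_self (endpoint_pos_itv p) => pt.
have [q [m [n [uq e _]]]] := chart_over pin pt.
by have [<- _] := endpoint_pos_modz e.
Qed.

Lemma over_upper_mate p t : over D t (z p) -> upper (mate p).
Proof.
have pin := inside_self (endpoint_pos_itv p) => tp.
have tin : inside a b t.
  by apply/curve_inside; have [-> _] := over_double tp; apply/curve_inside.
have [q [m [n [uq _ e]]]] := chart_over tin tp.
have [<- _] := endpoint_pos_modz e.
by rewrite mateK.
Qed.

Lemma is_over_endpoint p : is_over D (z p) = upper p.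
Proof.
apply/asboolP/idP => [[t]|up]; first exact: over_upper.
by exists (z (mate p)); exact: upper_over.
Qed.

Lemma endpoint_sign_pos p : endpoint_sign D (z p) = tangle_sign p.
Proof.
rewrite /tangle_sign; case: ifP => [rp|/negP np]; last first.
  apply: endpoint_sign_unlinked => t [/over_upper up|/over_upper_mate um];
    by apply: np; rewrite /real_endpoint ?up ?um ?orbT.
rewrite (endpoint_signE (real_linked rp)) -(chord_sign_mate rp).
have pi := endpoint_pos_itv p; have qi := endpoint_pos_itv (mate p).
have e := chart_crossing_sign qi pi; rewrite !chart_endpoint_pos in e.
apply: e; case/orP: rp => [/chord_double e|/chord_double]; first exact: esym e.
by rewrite mateK.
Qed.

Lemma endpoint_sign_support i s : a i < s < b i -> endpoint_sign D s != 0 ->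
  exists2 p, strand_of p == i & s = z p.
Proof.
move=> si /endpoint_sign_linked l; have sin := inside_self si.
have key p (m : int) : z p = s + m%:~R -> exists2 p, strand_of p == i & s = z p.
  move=> e; have pi := endpoint_pos_itv p; rewrite e in pi.
  have [ip m0] := disk_disjoint si pi.
  by exists p; [rewrite ip|rewrite e m0 addr0].
case: l => [st|ts].
  by have [p [m [n [_ e _]]]] := chart_over sin st; exact: key e.
have tin : inside a b (partner D s).
  by apply/curve_inside; have [-> _] := over_double ts; apply/curve_inside.
by have [p [m [n [_ _ e]]]] := chart_over tin ts; exact: key e.
Qed.

Lemma endpoint_pos_lt p q : strand_of p = strand_of q ->
  (z p < z q) = (param p < param q).
Proof.
move=> e; have pi := endpoint_pos_itv p; have qi := endpoint_pos_itv q.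
rewrite -!chart_endpoint_pos; move: pi qi; rewrite -e => pi qi.
by rewrite chart_lt.
Qed.

Lemma isum_chart (h : R -> int) i :
    (forall s, ~ inside a b s -> h s = 0) ->
    (forall s, h s != 0 -> endpoint_sign D s != 0) ->
  isum h (a i) (b i) = \sum_(p | strand_of p == i) h (z p).
Proof.
move=> hout hsupp; apply: isum_fin.
- by move=> p q _ _; exact: endpoint_pos_inj.
- by move=> p /eqP <-; have /andP[/ltW -> ->] := endpoint_pos_itv p.
move=> s /andP[]; rewrite le_eqVlt => /orP[/eqP <- _|as_ sb].
  by rewrite hout ?eqxx//; exact: (start_outside chart_disjoint).
by move=> /hsupp; apply: endpoint_sign_support; rewrite as_.
Qed.

(** The half-open interval from the entrance to [z p] contains the entrance itself, where a crossing
    on the boundary circle may have an endpoint. That endpoint belongs to the outside and is kept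
    apart from [sign_before]. *)
Lemma sign_sum_pos p :
  sign_sum D (z p) = sign_sum D (a (strand_of p)) +
    endpoint_sign D (a (strand_of p)) + sign_before p.
Proof.
have /andP[az zb] := endpoint_pos_itv p.
have /eqP := sign_sumB D (ltW az); rewrite subr_eq => /eqP ->.
rewrite [LHS]addrC -addrA; congr (_ + _).
set x := a _ in az *.
pose h0 s := if s == x then endpoint_sign D s else 0.
pose h1 s := if x < s then endpoint_sign D s else 0.
have lf (Q : pred R) : locally_finite
    (fun s => if Q s then endpoint_sign D s else 0).
  apply: locally_finite_sub (endpoint_sign_lf D) => s.
  by case: ifP; rewrite ?eqxx.
have -> : isum (endpoint_sign D) x (z p) = isum (fun s => h0 s + h1 s) x (z p).
  apply: eq_isum => s /andP[]; rewrite /h0 /h1 le_eqVlt => /orP[/eqP <- _|xs _].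
    by rewrite eqxx ltxx addr0.
  by rewrite (gt_eqF xs) xs add0r.
rewrite isum_add; [|exact: (lf (fun s => s == x))|exact: (lf (fun s => x < s))].
congr (_ + _).
  rewrite (@isum_fin _ _ _ _ unit (fun=> x) xpredT).
  - by rewrite big_const card_unit /= /h0 eqxx addr0.
  - by move=> [] [].
  - by move=> _ _; rewrite lexx.
  - by move=> t _; rewrite /h0; case: (eqVneq t x) => [-> _|_];
      [exists tt|rewrite eqxx].
rewrite (@isum_fin _ _ _ _ _ z
  (fun q => (strand_of q == strand_of p) && (param q < param p))).
- apply: eq_bigr => q /andP[/eqP e _]; rewrite /h1 -endpoint_sign_pos.
  by have := endpoint_pos_itv q; rewrite e => /andP[-> _].
- by move=> q q' _ _; exact: endpoint_pos_inj.
- move=> q /andP[/eqP e qp]; rewrite (endpoint_pos_lt e) qp andbT.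
  by have := endpoint_pos_itv q; rewrite e => /andP[/ltW].
- move=> t /andP[_ tz]; rewrite /h1; case: ifP => [xt t0|]; last by rewrite eqxx.
  have tp : a (strand_of p) < t < b (strand_of p) by rewrite xt (lt_trans tz).
  have [q /eqP e te] := endpoint_sign_support tp t0.
  by exists q => //; rewrite e eqxx -(endpoint_pos_lt e) -te.
Qed.

(** The value of G just after the entrance, past an endpoint that may sit at [a i]. *)
Definition strand_entry i : int := sign_sum D (a i) + endpoint_sign D (a i).

Lemma over_index_endpoint p : real_endpoint p ->
  over_index D (z p) = tangle_index strand_entry p.
Proof.
move=> /real_linked l; rewrite (over_indexE l) !sign_sum_pos endpoint_sign_pos.
by [].
Qed.

Lemma writhe_density_endpoint n p : writhe_density D n (z p) =
  if upper p && (tangle_index strand_entry p == n) then - tangle_sign p else 0.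
Proof.
rewrite /writhe_density is_over_endpoint endpoint_sign_pos.
case: (boolP (upper p)) => //= up.
by rewrite over_index_endpoint// /real_endpoint up.
Qed.

(** The sums over [a i, b i[ include the parameter [a i], which is outside; its contribution has to
    be removed. *)
Definition inner_part (h : R -> int) s : int := if `[< inside a b s >] then h s else 0.

Lemma inner_partE h i s : a i < s < b i -> inner_part h s = h s.
Proof. by move=> si; rewrite /inner_part asboolT//; exact: inside_self si. Qed.

Lemma isum_endpoint_sign i :
  isum (inner_part (endpoint_sign D)) (a i) (b i) = strand_total C i.
Proof.
rewrite isum_chart.
- apply: eq_bigr => p _.
  by rewrite (inner_partE _ (endpoint_pos_itv p)) endpoint_sign_pos.
- by move=> s sout; rewrite /inner_part asboolF.
- by move=> s; rewrite /inner_part; case: ifP => //; rewrite eqxx.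
Qed.

Lemma isum_writhe_density n :
  \sum_i isum (inner_part (writhe_density D n)) (a i) (b i) =
  tangle_writhe C strand_entry n.
Proof.
pose w := inner_part (writhe_density D n).
transitivity (\sum_i \sum_(p : endpoint C | strand_of p == i) w (z p)).
  apply: eq_bigr => i _; apply: isum_chart.
    by move=> s sout; rewrite /w /inner_part asboolF.
  move=> s; rewrite /w /inner_part; case: ifP => [_|_]; last by rewrite eqxx.
  by rewrite /writhe_density; case: ifP => //; rewrite ?oppr_eq0 ?eqxx.
rewrite /tangle_writhe [RHS]big_mkcond /=.
rewrite [RHS](partition_big (@strand_of _ _ _ C) xpredT)//=.
apply: eq_bigr => i _; apply: eq_bigr => p _.
by rewrite /w (inner_partE _ (endpoint_pos_itv p)) writhe_density_endpoint.
Qed.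

End Endpoints.
End Chart.

(** * Comparison of two diagrams outside of the disk *)

Section OutsideVelocity.
Variables (R : realType) (k : nat) (a b : 'I_k -> R).

Lemma outside_right s : ~ inside a b s -> (forall i (n : int), s != a i + n%:~R) ->
  \forall h \near 0^'+, ~ inside a b (h + s).
Proof.
move=> so sa; suff : \forall h \near 0^'+, forall i, ~ on_strand a b i (h + s).
  by apply: filterS => h hi [i /hi].
(* The translate of s in [a i, a i + 1[ is not [a i] and is off the strand, hence at or beyond
   [b i]; the next translate of the strand starts only at a i + 1. *)
apply: filter_forall => i; have [n /andP[n0 n1]] := floor_shift (s - a i).
have an : a i < s + n%:~R.
  rewrite lt_neqAle; apply/andP; split; last by lra.
  apply/eqP => e; have /eqP := sa i (- n); apply.
  by rewrite e mulrNz addrK.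
have bn : b i <= s + n%:~R.
  by rewrite leNgt; apply/negP => sb; apply: so; exists i, n; rewrite an.
near=> h; have h0 : 0 < h by [].
have h1 : h < a i + 1 - (s + n%:~R).
  by near: h; apply: nbhs_right_lt; lra.
move=> [m /andP[am bm]].
have nm : n < m + 1 by rewrite -(ltr_int R) rmorphD/=; lra.
have mn : m < n by rewrite -(ltr_int R); lra.
by move: nm; rewrite ltzD1 leNgt mn.
Unshelve. all: end_near. Qed.

Lemma outside_left s : ~ inside a b s -> (forall i (n : int), s != b i + n%:~R) ->
  \forall h \near 0^'-, ~ inside a b (h + s).
Proof.
move=> so sb; suff : \forall h \near 0^'-, forall i, ~ on_strand a b i (h + s).
  by apply: filterS => h hi [i /hi].
apply: filter_forall => i; have [n /andP[n0 n1]] := floor_shift (b i - s).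
have bn : s + (- n)%:~R < b i.
  rewrite mulrNz lt_neqAle; apply/andP; split; last by lra.
  by rewrite subr_eq; exact: sb.
have an : s + (- n)%:~R <= a i.
  by rewrite leNgt; apply/negP => sa; apply: so; exists i, (- n); rewrite sa.
rewrite mulrNz in an bn.
near=> h; have h0 : h < 0 by [].
have h1 : b i - 1 - (s - n%:~R) < h.
  by near: h; apply: nbhs_left_gt; lra.
move=> [m /andP[am bm]].
have nm : - n < m by rewrite -(ltr_int R) mulrNz; lra.
have mn : m < - n + 1 by rewrite -(ltr_int R) rmorphD/= mulrNz; lra.
by move: mn; rewrite ltzD1 leNgt nm.
Unshelve. all: end_near. Qed.

(** The curves agree on a one-sided neighbourhood of s: on the right unless s is an entrance modulo
    1, and in that case on the left, since s is then not an exit. A one-sided limit of the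
    difference quotients determines the derivative. *)
Lemma outside_velocity (c c' : R -> plane R) s :
    (forall i j (n : int), a i != b j + n%:~R) ->
    derivable c s 1 -> derivable c' s 1 ->
    (forall t, ~ inside a b t -> c' t = c t) ->
  ~ inside a b s -> derive1 c' s = derive1 c s.
Proof.
move=> ab dc dc' cc' so.
have quot (g : R -> plane R) : derivable g s 1 ->
    h^-1 *: (g (h + s) - g s) @[h --> 0^'] --> derive1 g s.
  rewrite /derivable /derive1 /= => dg; move: dg.
  by under eq_fun do rewrite /GRing.scale /= mulr1.
have [sa|sa] := pselect (forall i (n : int), s != a i + n%:~R).
  have q := cvg_dnbhs_at_right (quot _ dc).
  have q' := cvg_dnbhs_at_right (quot _ dc').
  apply: (cvg_unique (@norm_hausdorff _ (plane R)) q').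
  apply: cvg_trans q; apply: near_eq_cvg.
  have := outside_right so sa; apply: filterS => h ho.
  by rewrite !cc'.
have sb j (m : int) : s != b j + m%:~R.
  apply/eqP => sbm; apply: sa => i n; apply/eqP => san.
  have /eqP := ab i j (m - n); apply; rewrite rmorphB/= addrA -sbm san.
  by rewrite addrK.
have q := cvg_dnbhs_at_left (quot _ dc).
have q' := cvg_dnbhs_at_left (quot _ dc').
apply: (cvg_unique (@norm_hausdorff _ (plane R)) q').
apply: cvg_trans q; apply: near_eq_cvg.
have := outside_left so sb; apply: filterS => h ho.
by rewrite !cc'.
Qed.

End OutsideVelocity.

Section Outside.
Variables (R : realType) (D D' : diagram R) (k : nat) (a b : 'I_k -> R).
Hypothesis disj : disjoint_strands a b.
Hypothesis apart : forall i j (n : int), a i != b j + n%:~R.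
Hypothesis curve_out : forall s, ~ inside a b s -> curve D' s = curve D s.
Hypothesis over_out : forall s t, ~ inside a b s -> ~ inside a b t ->
  (over D' s t <-> over D s t).
Hypothesis double_inside : forall s t,
  double_point (curve D) s t -> inside a b s -> inside a b t.
Hypothesis double_inside' : forall s t,
  double_point (curve D') s t -> inside a b s -> inside a b t.

Lemma linked_outside s t : linked D s t -> ~ inside a b s -> ~ inside a b t.
Proof.
move=> /linked_sym/linked_double st so ti; apply: so; exact: double_inside st ti.
Qed.

Lemma linked_outside' s t : linked D' s t -> ~ inside a b s -> ~ inside a b t.
Proof.
move=> /linked_sym/linked_double st so ti; apply: so; exact: double_inside' st ti.
Qed.

Lemma over_outside s t : ~ inside a b s -> (over D' s t <-> over D s t).
Proof.
move=> so; split=> st; apply/over_out => //.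
  exact: linked_outside' (or_introl st) so.
exact: linked_outside (or_introl st) so.
Qed.

Lemma linked_iff_outside s t : ~ inside a b s -> (linked D' s t <-> linked D s t).
Proof.
move=> so; split=> l.
  have to_ := linked_outside' l so.
  by case: l => st; [left|right]; apply/over_out.
have to_ := linked_outside l so.
by case: l => st; [left|right]; apply/over_out.
Qed.

Lemma velocity_outside s : ~ inside a b s ->
  derive1 (curve D') s = derive1 (curve D) s.
Proof.
exact: (outside_velocity apart (@curve_derivable _ D s)
  (@curve_derivable _ D' s) curve_out).
Qed.

Lemma endpoint_sign_outside s : ~ inside a b s ->
  endpoint_sign D' s = endpoint_sign D s.
Proof.
move=> so; have [[t l]|no] := pselect (exists t, linked D s t).
  have l' := (linked_iff_outside t so).2 l.
  rewrite (endpoint_signE l) (endpoint_signE l').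
  by rewrite (velocity_outside so) (velocity_outside (linked_outside l so)).
rewrite !endpoint_sign_unlinked// => t l; apply: no; exists t => //.
exact/linked_iff_outside.
Qed.

Lemma inner_part_lf (h : R -> int) :
  locally_finite h -> locally_finite (inner_part a b h).
Proof.
apply: locally_finite_sub => s.
by rewrite /inner_part; case: ifP => //; rewrite eqxx.
Qed.

Let diff (h h' : R -> int) s : int := h' s - h s.

Let diff_inner (h h' : R -> int) : (forall s, ~ inside a b s -> h' s = h s) ->
  forall s, diff h h' s = inner_part a b h' s - inner_part a b h s.
Proof.
move=> hh s; rewrite /diff /inner_part; case: asboolP => // so.
by rewrite (hh _ so) !subrr.
Qed.

Let diff_out (h h' : R -> int) : (forall s, ~ inside a b s -> h' s = h s) ->
  forall s, ~ inside a b s -> diff h h' s = 0.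
Proof. by move=> hh s /hh e; rewrite /diff e subrr. Qed.

Let diff_periodic (h h' : R -> int) : periodic1 h -> periodic1 h' ->
  periodic1 (diff h h').
Proof. by move=> p p' s; rewrite /diff p p'. Qed.

Let isum_diff (h h' : R -> int) x y : locally_finite h -> locally_finite h' ->
    (forall s, ~ inside a b s -> h' s = h s) ->
  isum (diff h h') x y =
    isum (inner_part a b h') x y - isum (inner_part a b h) x y.
Proof.
move=> lf lf' hh; rewrite -isum_sub; [|exact: inner_part_lf..].
by apply: eq_isum => s _; exact: diff_inner.
Qed.

Hypothesis same_total : forall i,
  isum (inner_part a b (endpoint_sign D')) (a i) (b i) =
  isum (inner_part a b (endpoint_sign D)) (a i) (b i).

(** The difference of the two endpoint signs vanishes outside and has sum 0 along every strand, so
    its primitive takes a single value on the whole outside. *)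
Lemma sign_sum_outside x y : ~ inside a b x -> ~ inside a b y ->
  sign_sum D' x - sign_sum D' y = sign_sum D x - sign_sum D y.
Proof.
move=> xo yo.
have lf := endpoint_sign_lf D; have lf' := endpoint_sign_lf D'.
have prim_eq : prim (diff (endpoint_sign D) (endpoint_sign D')) x =
    prim (diff (endpoint_sign D) (endpoint_sign D')) y.
  apply: (prim_strands disj) => //.
  - exact: locally_finiteB lf' lf.
  - by apply: diff_periodic; exact: endpoint_sign_periodic.
  - by apply: diff_out; exact: endpoint_sign_outside.
  - move=> i; rewrite isum_diff//; last exact: endpoint_sign_outside.
    by apply/eqP; rewrite subr_eq0 same_total.
rewrite !prim_sub// -!sign_sumE in prim_eq.
rewrite (addrC (sign_sum D' x)) (addrC (sign_sum D x)).
move/eqP: prim_eq; rewrite subr_eq => /eqP ->; by ring.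
Qed.

Lemma over_index_outside s t : linked D s t -> ~ inside a b s ->
  over_index D' s = over_index D s.
Proof.
move=> l so; have l' := (linked_iff_outside t so).2 l.
rewrite (over_indexE l) (over_indexE l') (endpoint_sign_outside so).
by rewrite (sign_sum_outside (linked_outside l so) so).
Qed.

Lemma writhe_density_outside n s : ~ inside a b s ->
  writhe_density D' n s = writhe_density D n s.
Proof.
move=> so; rewrite /writhe_density /is_over.
have [[t st]|no] := pselect (exists t, over D s t); last first.
  rewrite (asboolF no) asboolF // => -[t st]; apply: no.
  by exists t; apply/over_outside.
have e1 : exists t, over D s t by exists t.
have e2 : exists t, over D' s t by exists t; apply/over_outside.
rewrite (asboolT e1) (asboolT e2) /=.
by rewrite (over_index_outside (over_linked st) so) (endpoint_sign_outside so).
Qed.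

Lemma diagram_writhe_local n :
  diagram_writhe D' n - diagram_writhe D n =
  \sum_i isum (inner_part a b (writhe_density D' n)) (a i) (b i) -
  \sum_i isum (inner_part a b (writhe_density D n)) (a i) (b i).
Proof.
have lf := @writhe_density_lf _ D n; have lf' := @writhe_density_lf _ D' n.
rewrite !diagram_writheE -isum_sub// -[in LHS]/(diff _ _).
rewrite (isum_strands disj).
- rewrite -sumrB; apply: eq_bigr => i _.
  by rewrite isum_diff//; exact: writhe_density_outside.
- exact: locally_finiteB lf' lf.
- by apply: diff_periodic; exact: writhe_density_periodic.
- by apply: diff_out; exact: writhe_density_outside.
Qed.

(** All entrances lie outside, so one constant serves for every strand. *)
Lemma strand_entry_shift : exists c : int, forall i,
  strand_entry D' a i = strand_entry D a i + c.
Proof.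
case: (pickP 'I_k) => [i0 _|no]; last by exists 0 => i; have := no i.
exists (sign_sum D' (a i0) - sign_sum D (a i0)) => i.
have ao := start_outside disj.
rewrite /strand_entry (endpoint_sign_outside (@ao i)).
have /eqP := sign_sum_outside (@ao i) (@ao i0).
by rewrite subr_eq => /eqP ->; ring.
Qed.

End Outside.

(** The rest of the diagram enters only through g, and g is chosen before n: this uniformity lets
    the bounds be summed over n. For a given move, the statement becomes a finite computation on two
    tables. *)
Lemma local_move_writhe (R : realType) k (T T' : tangle R k)
    (C : tangle_chords T) (C' : tangle_chords T') (D D' : diagram R) :
    (forall i u, derivable (strand T i) u 1) ->
    (forall i u, derivable (strand T' i) u 1) ->
    (forall i j, strand T i (-1) != strand T j 1) ->
    (forall i, strand_total C' i = strand_total C i) ->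
    local_move T T' D D' ->
  exists g, forall n, diagram_writhe D' n - diagram_writhe D n =
    tangle_writhe C' g n - tangle_writhe C g n.
Proof.
move=> dT dT' endT tot [f [f' [a [b []]]]].
move=> [df of_ df' of' UU] [r [m1 m2 m3 m4 m5]] [r' [m1' m2' m3' m4' m5']] cout oout.
have m3r i s : a i < s < b i -> derivable (r i) s 1 /\ 0 < derive1 (r i) s.
  by case: (m3 i) => h _; exact: h.
have m3i i : r i @` [set s | a i < s < b i] = [set u | -1 < u < 1].
  by case: (m3 i).
have m3r' i s : a i < s < b i -> derivable (r' i) s 1 /\ 0 < derive1 (r' i) s.
  by case: (m3' i) => h _; exact: h.
have m3i' i : r' i @` [set s | a i < s < b i] = [set u | -1 < u < 1].
  by case: (m3' i).
have disj := chart_disjoint m2 m3i.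
have apart i j n := chart_apart df dT m2 m3r m3i m4 n (endT i j).
have cin s : ~ inside a b s -> curve D' s = curve D s.
  by move=> so; apply: cout => /(m1 s).
have oin s t : ~ inside a b s -> ~ inside a b t -> (over D' s t <-> over D s t).
  by move=> so to_; apply: oout => [/(m1 s)|/(m1 t)].
have din s t : double_point (curve D) s t -> inside a b s -> inside a b t.
  by move=> [e _] /(m1 s) si; apply/(m1 t); rewrite -e.
have din' s t : double_point (curve D') s t -> inside a b s -> inside a b t.
  by move=> [e _] /(m1' s) si; apply/(m1' t); rewrite -e.
have iE := isum_endpoint_sign df of_ dT m1 m2 m3r m3i m4 m5 C.
have iE' := isum_endpoint_sign df' of' dT' m1' m2' m3r' m3i' m4' m5' C'.
have st i : isum (inner_part a b (endpoint_sign D')) (a i) (b i) =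
    isum (inner_part a b (endpoint_sign D)) (a i) (b i).
  by rewrite iE iE' tot.
have [c shift] := strand_entry_shift disj apart cin oin din din' st.
exists (strand_entry D a) => n.
rewrite (diagram_writhe_local disj apart cin oin din din' st).
rewrite (isum_writhe_density df of_ dT m1 m2 m3r m3i m4 m5 C).
rewrite (isum_writhe_density df' of' dT' m1' m2' m3r' m3i' m4' m5' C').
by rewrite (funext shift) tangle_writhe_shift.
Qed.

(** * Chords of the model tangles *)

Section TangleSigns.
Variables (R : realType) (k : nat) (T : tangle R k) (C : tangle_chords T).
Implicit Types p q : endpoint C.

Lemma real_endpoint_mate p : real_endpoint (mate p) = real_endpoint p.
Proof. by rewrite /real_endpoint mateK orbC. Qed.

Lemma tangle_sign_mate p : tangle_sign (mate p) = - tangle_sign p.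
Proof.
rewrite /tangle_sign real_endpoint_mate; case: ifP => [rp|_]; last by rewrite oppr0.
have rm : real_endpoint (mate p) by rewrite real_endpoint_mate.
have e1 := chord_sign_mate rp; have e2 := chord_sign_mate rm; rewrite mateK in e2.
exact (etrans (esym e2) (etrans (sgz_det2C _ _) (congr1 -%R e1))).
Qed.

Lemma normr_tangle_sign p : `|tangle_sign p| <= 1.
Proof.
rewrite /tangle_sign; case: ifP => [rp|_]; last by rewrite normr0.
by rewrite -(chord_sign_mate rp) normr_sgz; case: (_ != 0).
Qed.

(** For a fixed g each chord has one index, so it contributes to at most one term, and by at most
    1. *)
Lemma sum_normr_tangle_writhe (g : 'I_k -> int) (s : seq int) : uniq s ->
  \sum_(n <- s) `|tangle_writhe C g n| <= (#|[pred p : endpoint C | upper p]|)%:Z.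
Proof.
move=> us.
apply: (@le_trans _ _ (\sum_(n <- s)
    \sum_(p : endpoint C | upper p) ((tangle_index g p == n) : nat)%:Z)).
  apply: ler_sum => n _; apply: (le_trans (ler_norm_sum _ _ _)).
  rewrite big_mkcondr /=; apply: ler_sum => p _.
  by rewrite normrN; case: ifP => _ //; exact: normr_tangle_sign.
rewrite exchange_big /= -sum1_card (raddf_sum Posz) /=.
apply: ler_sum => p _; rewrite -(raddf_sum Posz) lez_nat.
have -> : (\sum_(n <- s) (tangle_index g p == n) = count_mem (tangle_index g p) s)%N.
  by rewrite -sum1_count [RHS]big_mkcond /=; apply: eq_bigr => n _;
     rewrite eq_sym; case: eqP.
by rewrite count_uniq_mem//; case: (_ \in _).
Qed.

(** In each model with crossings, every strand carries exactly two crossing points; [bar] exchanges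
    them. *)
Variable bar : endpoint C -> endpoint C.
Hypothesis bar_neq : forall p, bar p != p.
Hypothesis bar_strand : forall p q,
  (strand_of q == strand_of p) = (q == p) || (q == bar p).

Lemma strand_of_bar p : strand_of (bar p) = strand_of p.
Proof. by apply/eqP; rewrite bar_strand eqxx orbT. Qed.

Lemma barK : involutive bar.
Proof.
move=> p; have := bar_strand (bar p) p.
rewrite strand_of_bar eqxx => /esym/orP[/eqP e|/eqP //].
by have := bar_neq p; rewrite -e eqxx.
Qed.

Lemma param_bar_neq p : param (bar p) != param p.
Proof.
apply: contra (bar_neq p) => /eqP e; apply/eqP.
by apply: endpoint_inj e; exact: strand_of_bar.
Qed.

Lemma sum_strand_bar (F : endpoint C -> int) p :
  \sum_(q | strand_of q == strand_of p) F q = F p + F (bar p).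
Proof.
rewrite (bigD1 p)//= (bigD1 (bar p))//=; last first.
  by rewrite strand_of_bar eqxx bar_neq.
rewrite big1 ?addr0// => q; rewrite bar_strand.
by case: (q == p) => //=; case: (q == bar p).
Qed.

Lemma strand_total0 : (forall p, tangle_sign p + tangle_sign (bar p) = 0) ->
  forall i, strand_total C i = 0.
Proof.
move=> h i; rewrite /strand_total.
case: (pickP (fun p : endpoint C => strand_of p == i)) => [p /eqP <-|no].
  by rewrite sum_strand_bar.
by rewrite big1// => p; rewrite no.
Qed.

Lemma sign_before_bar p :
  sign_before p = if param (bar p) < param p then tangle_sign (bar p) else 0.
Proof.
rewrite /sign_before big_mkcondr /= sum_strand_bar.
by rewrite ltxx add0r.
Qed.

(** The two endpoints of the chord are consecutive on one strand. If the initial one comes first,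
    its arc is empty in the disk; otherwise the complementary arc is, and the index is again 0
    because the mates have opposite signs. *)
Lemma tangle_writhe_self_crossing (g : 'I_k -> int) (n : int) : bar =1 @mate _ _ _ C ->
  n != 0 -> tangle_writhe C g n = 0.
Proof.
move=> bm n0; rewrite /tangle_writhe big1// => p /andP[_ /eqP e].
have sm : strand_of (mate p) = strand_of p by rewrite -bm strand_of_bar.
have := param_bar_neq p; move: n0; rewrite -e /tangle_index sm.
rewrite (sign_before_bar p) (sign_before_bar (mate p)) !bm mateK.
rewrite tangle_sign_mate; move: (g _) (tangle_sign p) => x y.
by case: ltgtP => // _ + _; rewrite (_ : _ - _ = 0) ?eqxx//; ring.
Qed.

Hypothesis bar_mate : forall p, mate (bar p) = bar (mate p).

(** The chords at p and [bar p] have opposite signs and, whichever order the points take on the two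
    strands, the same index. Reindexing by [bar] therefore negates the writhe. *)
Lemma tangle_writhe_bigon (g : 'I_k -> int) (n : int) :
    (forall p, upper (bar p) = upper p) ->
    (forall p, tangle_sign (bar p) = - tangle_sign p) ->
  tangle_writhe C g n = 0.
Proof.
move=> ub tb.
have ib p : tangle_index g (bar p) = tangle_index g p.
  rewrite /tangle_index !sign_before_bar !bar_mate !strand_of_bar !barK !tb.
  rewrite !tangle_sign_mate.
  have := param_bar_neq p; have := param_bar_neq (mate p).
  by case: ltgtP => //= _ _; case: ltgtP => //= _ _; ring.
have : tangle_writhe C g n = - tangle_writhe C g n.
  rewrite {1}/tangle_writhe (reindex_inj (inv_inj barK)) /= -sumrN.
  by apply: eq_big => p => [|_]; rewrite ?ub ?ib// tb.
by move/eqP; rewrite -addr_eq0 -mulr2n mulrn_eq0 => /eqP.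
Qed.

End TangleSigns.

(** * Crossings of bare curves, orientations and half-turns *)

Section Crossings.
Variable R : realType.

(** No over/under information is attached yet: one table per set of curves serves for all crossing
    types and, through the transforms below, for all orientations. *)
Record crossings k (c : 'I_k -> R -> plane R) := Crossings {
  cpoint : finType;
  cstrand : cpoint -> 'I_k;
  cparam : cpoint -> R;
  cmate : cpoint -> cpoint;
  csign : cpoint -> int;
  cparam_itv : forall p, -1 < cparam p < 1;
  cpoint_inj : forall p q, cstrand p = cstrand q -> cparam p = cparam q -> p = q;
  cmateK : involutive cmate;
  cdouble : forall p, c (cstrand p) (cparam p) = c (cstrand (cmate p)) (cparam (cmate p));
  csign_mate : forall p,
    sgz (det2 (derive1 (c (cstrand (cmate p))) (cparam (cmate p)))
              (derive1 (c (cstrand p)) (cparam p))) = csign p;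
  cexhaust : forall i u j v, -1 < u < 1 -> -1 < v < 1 ->
    c i u = c j v -> i != j \/ u != v ->
    exists p, [/\ cstrand p = i, cparam p = u,
      cstrand (cmate p) = j & cparam (cmate p) = v]
}.

Definition chords_of k (c : 'I_k -> R -> plane R) (X : crossings c)
    (t : 'I_k -> R -> 'I_k -> R -> Prop) (up : pred (cpoint X))
    (upP : forall p, reflect
      (t (cstrand p) (cparam p) (cstrand (cmate p)) (cparam (cmate p))) (up p))
    (upN : forall p, up p -> ~~ up (cmate p)) : tangle_chords (Tangle c t).
refine (@TangleChords R k (Tangle c t) (cpoint X) (@cstrand _ _ X) (@cparam _ _ X)
  (@cmate _ _ X) up (@csign _ _ X) (@cparam_itv _ _ X) (@cpoint_inj _ _ X)
  (@cmateK _ _ X) upN (fun p _ => cdouble p) (fun p => elimT (upP p))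
  (fun p _ => csign_mate p) _).
move=> i u j v u1 v1 e ne tuv.
have [p [pi pu pj pv]] := cexhaust X u1 v1 e ne.
by exists p; split=> //; apply/upP; rewrite pi pu pj pv.
Defined.

Definition chords_void k (c : 'I_k -> R -> plane R) :
  tangle_chords (Tangle c (@no_over R k)).
refine (@TangleChords R k (Tangle c (@no_over R k)) void
  (of_void _) (of_void _) id pred0 (of_void _) _ _ _ _ _ _ _ _); by case.
Defined.

Lemma tangle_writhe_void k (c : 'I_k -> R -> plane R) g n :
  tangle_writhe (chords_void c) g n = 0.
Proof. by rewrite /tangle_writhe big_pred0. Qed.

Lemma strand_total_void k (c : 'I_k -> R -> plane R) i :
  strand_total (chords_void c) i = 0.
Proof. by rewrite /strand_total big1// => -[]. Qed.

Lemma derivable_scale (c : R -> plane R) (s u : R) : (forall u, derivable c u 1) ->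
  derivable (fun u => c (s * u)) u 1 /\
  derive1 (fun u => c (s * u)) u = s *: derive1 c (s * u).
Proof.
move=> dc; have ds : is_derive u (1 : R) (fun u : R => s * u) s.
  rewrite -[X in is_derive _ _ _ X]mulr1; exact: is_deriveZ.
have df : differentiable (id : plane R -> plane R) (c (s * u)) by [].
have [h1 h2] := derivable_curve_comp df (dc (s * u)) (@ex_derive _ _ _ _ _ _ _ ds).
split=> //; rewrite h2 /tangent_map diff_id; congr (_ *: _).
by rewrite derive1E; exact: derive_val.
Qed.

End Crossings.

Section CrossingTransforms.
Variables (R : realType) (k : nat) (c : 'I_k -> R -> plane R) (X : crossings c).
Hypothesis dc : forall i u, derivable (c i) u 1.

Lemma sgz_sign (e : bool) : sgz ((-1) ^+ e : R) = (-1) ^+ e.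
Proof. by case: e; rewrite ?sgzN1 ?sgz1. Qed.

Lemma orient_derivable (o : 'I_k -> bool) i u : derivable (orient o c i) u 1.
Proof. exact: (derivable_scale _ _ (@dc i)).1. Qed.

Lemma orient_velocity (o : 'I_k -> bool) i u :
  derive1 (orient o c i) u = (-1) ^+ o i *: derive1 (c i) ((-1) ^+ o i * u).
Proof. exact: (derivable_scale _ _ (@dc i)).2. Qed.

Lemma sgz_det2_scale (x y : R) (u v : plane R) :
  sgz (det2 (x *: u) (y *: v)) = sgz x * sgz y * sgz (det2 u v).
Proof.
have -> : det2 (x *: u) (y *: v) = x * y * det2 u v.
  by rewrite /det2 !planeZ /=; ring.
by rewrite !sgzM.
Qed.

Lemma opp_itv (u : R) : -1 < u < 1 -> -1 < - u < 1.
Proof. by move=> /andP[? ?]; apply/andP; split; lra. Qed.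

Lemma sign_itv (e : bool) (u : R) : -1 < u < 1 -> -1 < (-1) ^+ e * u < 1.
Proof. by case: e => /=; rewrite ?mul1r// mulN1r ltrN2 ltrNl andbC. Qed.

Section Orient.
Variable o : 'I_k -> bool.
Let st := @cstrand _ _ _ X.
Let s p : R := (-1) ^+ o (st p).

(** Reversing a strand negates its parameters and its velocity, so the sign of a crossing is
    multiplied by the orientation signs of both strands through it. *)
Definition orient_crossings : crossings (orient o c).
refine (@Crossings R k (orient o c) (cpoint X) st (fun p => s p * cparam p)
  (@cmate _ _ _ X)
  (fun p => (-1) ^+ o (st (cmate p)) * (-1) ^+ o (st p) * csign p) _ _ (@cmateK _ _ _ X)
  _ _ _).
- by move=> p; apply: sign_itv; exact: cparam_itv.
- move=> p q epq; rewrite /s epq => /(can_inj (signrMK _)) e.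
  exact: cpoint_inj epq e.
- by move=> p; rewrite /orient !signrMK cdouble.
- move=> p; rewrite !orient_velocity !signrMK sgz_det2_scale !sgz_sign.
  exact (congr1 _ (csign_mate p)).
- move=> i u j v u1 v1 e ne.
  have [p [pi pu pj pv]] : exists p : cpoint X, [/\ cstrand p = i,
      cparam p = (-1) ^+ o i * u, cstrand (cmate p) = j &
      cparam (cmate p) = (-1) ^+ o j * v].
    apply: cexhaust => //; try exact: sign_itv.
    have [ij|] := eqVneq i j; last by left.
    case: ne => [/eqP //|uv]; right; rewrite ij.
    by apply: contra uv => /eqP /(can_inj (signrMK _)) ->.
  by exists p; rewrite /s /st pi pj pu pv !signrMK.
Defined.
End Orient.

(** A half-turn of the plane combined with a reversal of time: velocities at corresponding points
    are unchanged, hence also the crossing signs, while the order of the points on each strand is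
    reversed. *)
Definition opposite (i : 'I_k) (u : R) : plane R := - c i (- u).

Lemma opposite_derive i u : derivable (opposite i) u 1 /\
  derive1 (opposite i) u = derive1 (c i) (- u).
Proof.
have [d1 d2] := derivable_scale (-1) u (@dc i).
have e : opposite i = - (fun u => c i (-1 * u)).
  by apply/funext => x; rewrite /opposite -[RHS]/(- c i (-1 * x)) mulN1r.
rewrite e; split; first exact: derivableN.
rewrite derive1E deriveN// -derive1E d2 mulN1r scaleN1r opprK.
by [].
Qed.

Definition opposite_crossings : crossings opposite.
refine (@Crossings R k opposite (cpoint X) (@cstrand _ _ _ X)
  (fun p => - cparam p) (@cmate _ _ _ X) (@csign _ _ _ X) _ _ (@cmateK _ _ _ X)
  _ _ _).
- by move=> p; apply: opp_itv; exact: cparam_itv.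
- by move=> p q epq /oppr_inj e; exact: cpoint_inj epq e.
- by move=> p; rewrite /opposite !opprK cdouble.
- by move=> p; rewrite !(opposite_derive _ _).2 !opprK csign_mate.
- move=> i u j v u1 v1 /oppr_inj e ne.
  have [p [pi pu pj pv]] : exists p : cpoint X, [/\ cstrand p = i,
      cparam p = - u, cstrand (cmate p) = j & cparam (cmate p) = - v].
    apply: cexhaust => //.
    - exact: opp_itv.
    - exact: opp_itv.
    - by case: ne; [left|right; rewrite eqr_opp].
  by exists p; rewrite pi pj pu pv !opprK.
Defined.

End CrossingTransforms.

Section CubicCurves.
Variable R : realType.

(** All model curves have coordinates of degree at most 3, so one derivative computation covers them
    all. *)
Definition cubic (q : R * R * R * R) (u : R) : R :=
  q.1.1.1 + q.1.1.2 * u + q.1.2 * u ^+ 2 + q.2 * u ^+ 3.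

Lemma is_derive_cubic q (u : R) :
  is_derive u (1 : R) (cubic q) (q.1.1.2 + 2 * q.1.2 * u + 3 * q.2 * u ^+ 2).
Proof.
have d1 : is_derive u (1 : R) (id : R -> R) 1 by exact: is_derive_id.
have d2 := is_deriveM d1 d1; have d3 := is_deriveM d2 d1.
have d0 : is_derive u (1 : R) (cst q.1.1.1 : R -> R) 0 by exact: is_derive_cst.
have d := is_deriveD (is_deriveD (is_deriveD d0 (is_deriveZ q.1.1.2 d1))
  (is_deriveZ q.1.2 d2)) (is_deriveZ q.2 d3).
have e : cubic q = cst q.1.1.1 + q.1.1.2 \*: id + q.1.2 \*: (id * id) +
    q.2 \*: (id * id * id).
  apply/funext => x; rewrite /cubic.
  rewrite -[RHS]/(q.1.1.1 + q.1.1.2 * x + q.1.2 * (x * x) + q.2 * (x * x * x)).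
  by ring.
rewrite e; apply: (is_derive_eq d).
rewrite -[LHS]/(0 + q.1.1.2 * 1 + q.1.2 * (u * 1 + u * 1) +
  q.2 * ((u * u) * 1 + u * (u * 1 + u * 1))).
by ring.
Qed.

Lemma cubic_curve (c : R -> plane R) (x y : R * R * R * R) :
    (forall u, c u = (cubic x u, cubic y u)) ->
  (forall u, derivable c u 1) /\
  (forall u, derive1 c u = (x.1.1.2 + 2 * x.1.2 * u + 3 * x.2 * u ^+ 2,
                            y.1.1.2 + 2 * y.1.2 * u + 3 * y.2 * u ^+ 2)).
Proof.
move=> cE; have -> : c = fun u => (cubic x u, cubic y u) by exact/funext.
have dx u := is_derive_cubic x u; have dy u := is_derive_cubic y u.
have ddx u : differentiable (cubic x) u.
  by apply/derivable1_diffP; exact: (@ex_derive _ _ _ _ _ _ _ (dx u)).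
have ddy u : differentiable (cubic y) u.
  by apply/derivable1_diffP; exact: (@ex_derive _ _ _ _ _ _ _ (dy u)).
have dxy u : differentiable (fun u => (cubic x u, cubic y u)) u.
  exact: differentiable_pair.
split=> u; first by apply/derivable1_diffP.
apply: (etrans (derive1E' (dxy u))).
apply: (etrans (congr1 (fun h : R -> plane R => h 1) (diff_pair (ddx u) (ddy u)))).
have ex := etrans (esym (deriveE (1 : R) (ddx u))) (@derive_val _ _ _ _ _ _ _ (dx u)).
have ey := etrans (esym (deriveE (1 : R) (ddy u))) (@derive_val _ _ _ _ _ _ _ (dy u)).
by rewrite -ex -ey.
Qed.

End CubicCurves.

(** * The triangle: moves III and vDelta-moves *)

Section Triangle.
Variable R : realType.

Lemma segment_curve (p q : plane R) :
  (forall u, derivable (segment p q) u 1) /\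
  (forall u, derive1 (segment p q) u = ((q.1 - p.1) / 2, (q.2 - p.2) / 2)).
Proof.
have [|d v] := @cubic_curve R (segment p q)
    ((p.1 + q.1) / 2, (q.1 - p.1) / 2, 0, 0) ((p.2 + q.2) / 2, (q.2 - p.2) / 2, 0, 0).
  by move=> u; rewrite /segment planeD !planeZ /cubic /=; congr pair; ring.
by split=> // u; rewrite v /= !mulr0 !mul0r !addr0.
Qed.

Lemma triangle_derivable (i : 'I_3) u : derivable (@triangle R i) u 1.
Proof. by case: i => [[|[|i]] h]; exact: (segment_curve _ _).1. Qed.

Definition triangle_point : finType := ('I_3 * bool)%type.
Implicit Types p q : triangle_point.

(** The vertices lie at -1/5 and 1/5 on the horizontal strand, and at -1/7 and 1/7 on the two
    others, which are parametrized by longer sides of the model. *)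
Definition triangle_param p : R :=
  (if p.2 then 1 else -1) * (if p.1 == 0 :> nat then 5^-1 else 7^-1).

(* Strand i meets strand i - 1 before it meets strand i + 1. *)
Definition triangle_mate p : triangle_point :=
  if p.2 then (ordS p.1, false) else (ord_pred p.1, true).

Definition triangle_bar p : triangle_point := (p.1, ~~ p.2).

Definition triangle_sign p : int := if p.2 then -1 else 1.

Let triangle_param_itv p : -1 < triangle_param p < 1.
Proof.
by rewrite /triangle_param; case: p => i [] /=; case: ifP => _;
  apply/andP; split; lra.
Qed.

Let triangle_inj p q : p.1 = q.1 -> triangle_param p = triangle_param q -> p = q.
Proof.
case: p q => [i c] [j d] /= -> h; congr pair; move: h.
by rewrite /triangle_param; case: c d => [] [] //=; case: ifP => _ h; exfalso; lra.
Qed.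

Lemma triangle_mateK : involutive triangle_mate.
Proof. by case=> i [] /=; rewrite /triangle_mate /= ?ordSK ?ord_predK. Qed.

Let triangle_double p : triangle p.1 (triangle_param p) =
  triangle (triangle_mate p).1 (triangle_param (triangle_mate p)).
Proof.
case: p => [[[|[|[|//]]] h] []]; rewrite /triangle /segment /triangle_param /= ;
  rewrite !planeD !planeZ /=; congr pair; try lra.
Qed.

Let triangle_sign_mate p :
  sgz (det2 (derive1 (@triangle R (triangle_mate p).1) (triangle_param (triangle_mate p)))
            (derive1 (@triangle R p.1) (triangle_param p))) = triangle_sign p.
Proof.
case: p => [[[|[|[|//]]] h] []]; rewrite /triangle /triangle_sign /=
  !(segment_curve _ _).2 /det2 /=; 
  first [rewrite gtr0_sgz //; lra|rewrite ltr0_sgz //; lra].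
Qed.

Let triangle_exhaust (i : 'I_3) (u : R) (j : 'I_3) (v : R) : -1 < u < 1 -> -1 < v < 1 ->
    @triangle R i u = triangle j v -> i != j \/ u != v ->
  exists p, [/\ p.1 = i, triangle_param p = u,
      (triangle_mate p).1 = j & triangle_param (triangle_mate p) = v].
Proof.
move=> _ _; case: i j => [[|[|[|//]]] hi] [[|[|[|//]]] hj];
  rewrite /triangle /segment /= !planeD !planeZ /= => -[e1 e2] ne.
all: first
  [ by case: ne => [//|/eqP[]]; lra
  | exists (Ordinal hi, true); split; rewrite /triangle_param //=;
      solve [exact: val_inj|lra]
  | exists (Ordinal hi, false); split; rewrite /triangle_param //=;
      solve [exact: val_inj|lra] ].
Qed.

Definition triangle_crossings : crossings (@triangle R) :=
  Crossings triangle_param_itv triangle_inj triangle_mateK triangle_double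
    triangle_sign_mate triangle_exhaust.

End Triangle.

Section TriangleMoves.
Variable R : realType.
Implicit Types p q : triangle_point.

Lemma triangle_bar_neq p : triangle_bar p != p.
Proof. by case: p => i []; rewrite /triangle_bar xpair_eqE andbF. Qed.

Lemma triangle_bar_strand p q :
  (q.1 == p.1) = (q == p) || (q == triangle_bar p).
Proof.
case: p q => i c [j d]; rewrite /triangle_bar !xpair_eqE /=.
by case: (j == i); case: c d => [] [].
Qed.

Definition triangle_upper (h : rel 'I_3) p : bool := h p.1 (triangle_mate p).1.

Section Oriented.
Variables (o : 'I_3 -> bool) (h : rel 'I_3).
Hypothesis h_asym : forall p, triangle_upper h p -> ~~ triangle_upper h (triangle_mate p).

Let X := orient_crossings (triangle_crossings R) (@triangle_derivable R) o.

Definition triangle_chords :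
    tangle_chords (Tangle (orient o (@triangle R)) (strand_over h)) :=
  chords_of (X := X) (fun p => @idP (triangle_upper h p)) h_asym.

Lemma opposite_triangle_derivable i u : derivable (@opposite_triangle R i) u 1.
Proof. exact: (opposite_derive (@triangle_derivable R) i u).1. Qed.

Let X' := orient_crossings
  (opposite_crossings (triangle_crossings R) (@triangle_derivable R))
  opposite_triangle_derivable o.

Definition opposite_triangle_chords :
    tangle_chords (Tangle (orient o (@opposite_triangle R)) (strand_over h)) :=
  chords_of (X := X') (fun p => @idP (triangle_upper h p)) h_asym.

Local Notation C := triangle_chords.
Local Notation C' := opposite_triangle_chords.

Lemma tangle_sign_opposite p : tangle_sign (C := C') p = tangle_sign (C := C) p.
Proof. by []. Qed.

Lemma strand_total_opposite i : strand_total C' i = strand_total C i.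
Proof. by []. Qed.

Let paramE p : param (t := C) p = (-1) ^+ o p.1 * triangle_param R p.
Proof. by []. Qed.

Let param_opposite p : param (t := C') p = - param (t := C) p.
Proof. by rewrite paramE -mulrN. Qed.

Let param_bar p : param (t := C) (triangle_bar p) = - param (t := C) p.
Proof.
rewrite !paramE -mulrN /triangle_bar /triangle_param /=; congr (_ * _).
by case: p.2; rewrite /= ?mulN1r ?mul1r ?opprK.
Qed.

Let param_bar_lt p :
  (param (t := C) (triangle_bar p) < param (t := C) p) = (p.2 != o p.1).
Proof.
rewrite param_bar paramE -subr_gt0 opprK /triangle_param.
case: p => i c /=; set w := (if i == 0 :> nat then _ else _).
have w0 : 0 < w by rewrite /w; case: ifP => _; lra.
case: c; case: (o i); rewrite /= ?expr1 ?expr0.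
- by apply/negbTE; rewrite -leNgt; lra.
- by apply/idP; lra.
- by apply/idP; lra.
- by apply/negbTE; rewrite -leNgt; lra.
Qed.

Let bar_neq p : triangle_bar p != p. Proof. exact: triangle_bar_neq. Qed.
Let bar_strand p q : (q.1 == p.1) = (q == p) || (q == triangle_bar p).
Proof. exact: triangle_bar_strand. Qed.

(** The change of [sign_before] at p when the other point of the strand moves to the other side of
    p: its sign is removed if that point came first, and added otherwise. *)
Let twist p : int :=
  tangle_sign (C := C) (triangle_bar p) - sign_before (C := C) p *+ 2.

Let sign_before_opposite p :
  sign_before (C := C') p = sign_before (C := C) p + twist p.
Proof.
rewrite /twist (@sign_before_bar _ _ _ C' _ bar_neq bar_strand).
rewrite (@sign_before_bar _ _ _ C _ bar_neq bar_strand).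
rewrite !param_opposite ltrN2 tangle_sign_opposite.
have := @param_bar_neq _ _ _ C _ bar_neq bar_strand p.
by case: ltgtP => // _ _; ring.
Qed.

(* Each strand changes the index of a crossing of the two others by an amount
   that depends only on the orientation of that strand. *)
Let twistE p : twist p =
  if real_endpoint (C := C) (triangle_bar p)
  then - (-1) ^+ o (triangle_mate (triangle_bar p)).1 else 0.
Proof.
rewrite /twist (@sign_before_bar _ _ _ C _ bar_neq bar_strand) param_bar_lt.
rewrite /tangle_sign; case: ifP => _; last by rewrite if_same.
rewrite (_ : local_sign (t := C) (triangle_bar p) =
  (-1) ^+ o (triangle_mate (triangle_bar p)).1 * (-1) ^+ o p.1 *
  (if p.2 then 1 else -1)); last by case: p => i [].
by case: p.2; case: (o p.1); rewrite /= ?expr0 ?expr1; ring.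
Qed.

(** At a real crossing of two strands, the third strand meets both of them in real crossings or both
    in virtual ones. Two real crossings and one virtual crossing, as in the forbidden moves, would
    violate this. *)
Hypothesis h_third : forall p, triangle_upper h p ->
  real_endpoint (C := C) (triangle_bar (triangle_mate p)) =
  real_endpoint (C := C) (triangle_bar p).

Let twist_mate p : triangle_upper h p -> twist (triangle_mate p) = twist p.
Proof.
move=> up; rewrite !twistE h_third//; congr (if _ then - (-1) ^+ o _ else _).
by case: p {up} => [[[|[|[|//]]] ?] []]; apply: val_inj.
Qed.

(** The running sums at the two endpoints of a chord change by the same [twist], which cancels in
    the index. *)
Lemma tangle_writhe_opposite (g : 'I_3 -> int) (n : int) :
  tangle_writhe C' g n = tangle_writhe C g n.
Proof.
rewrite /tangle_writhe; apply: eq_big => [p|p _]; last by rewrite tangle_sign_opposite.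
apply: andb_id2l => up; congr (_ == n).
rewrite /tangle_index tangle_sign_opposite !sign_before_opposite.
rewrite (twist_mate up); move: (twist p) => x.
rewrite -[strand_of (t := C') p]/(strand_of (t := C) p).
rewrite -[strand_of (t := C') (mate p)]/(strand_of (t := C) (mate p)).
rewrite -[mate (t := C') p]/(mate (t := C) p).
by ring.
Qed.

End Oriented.

Lemma RIII_asym h p : RIII_over h -> triangle_upper h p ->
  ~~ triangle_upper h (triangle_mate p).
Proof.
rewrite /triangle_upper triangle_mateK; case=> [height _|//|i0 j0 ij0].
  by rewrite -leqNgt; exact: ltnW.
move=> /andP[/eqP -> /eqP ->]; apply/nandP; left.
by rewrite eq_sym.
Qed.

Lemma RIII_third h (hR : RIII_over h) (o : 'I_3 -> bool)
    (ha : forall p, triangle_upper h p -> ~~ triangle_upper h (triangle_mate p)) p :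
  triangle_upper h p ->
  real_endpoint (C := triangle_chords o ha) (triangle_bar (triangle_mate p)) =
  real_endpoint (C := triangle_chords o ha) (triangle_bar p).
Proof.
rewrite /real_endpoint /= /triangle_upper !triangle_mateK.
case: hR => [height hi|//|i0 j0 ij0].
  have ne (i j : 'I_3) : i != j -> (height j < height i)%N || (height i < height j)%N.
    by move=> ij; rewrite orbC -neq_ltn; apply: contra ij => /eqP /hi ->.
  by move=> _; rewrite !ne//; case: p => [[[|[|[|//]]] ?] []].
move=> /andP[/eqP p1 /eqP p2]; rewrite -p1 -p2.
by case: p {p1 p2} => [[[|[|[|//]]] ?] []].
Qed.

Lemma vDelta_asym x p : triangle_upper (vDelta_over x) p ->
  ~~ triangle_upper (vDelta_over x) (triangle_mate p).
Proof.
by rewrite /triangle_upper triangle_mateK; case: p x => [[[|[|[|//]]] ?] []] [].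
Qed.

Definition vDelta_chords (w x : bool) :=
  triangle_chords (fun=> w) (@vDelta_asym x).

(** Each strand passes over once and under once, and the three crossings have the same sign, so its
    two endpoint signs cancel. *)
Lemma strand_total_vDelta w x i : strand_total (vDelta_chords w x) i = 0.
Proof.
apply: (@strand_total0 _ _ _ (vDelta_chords w x) _ triangle_bar_neq
  triangle_bar_strand).
suff h (p : triangle_point) : tangle_sign (C := vDelta_chords w x) p +
    tangle_sign (C := vDelta_chords w x) (triangle_bar p) = 0 by exact: h.
rewrite /tangle_sign /real_endpoint /= /triangle_upper !triangle_mateK.
by case: p x w => [[[|[|[|//]]] ?] []] [] [].
Qed.

Lemma card_vDelta w x :
  #|[pred p : endpoint (vDelta_chords w x) | upper p]| = 3%N.
Proof.
rewrite (@eq_card triangle_point _ [predX [pred _ : 'I_3 | true] & pred1 x]).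
  by rewrite cardX card1 muln1 cardT size_enum_ord.
move=> p; rewrite !inE /= /triangle_upper.
by case: p x => [[[|[|[|//]]] ?] []] [].
Qed.

End TriangleMoves.

(** * The curl: moves I *)

Section Curl.
Variable R : realType.

Let curl_cubic (u : R) : curl u =
  (cubic (0, - 5^-1, 0, 4 / 5) u, cubic (0, 0, 4 / 5, 0) u).
Proof. by rewrite /curl /cubic /=; congr pair; ring. Qed.

Lemma curl_derivable (i : 'I_1) u : derivable ((fun=> @curl R) i) u 1.
Proof. exact: (cubic_curve curl_cubic).1. Qed.

Definition curl_param (p : bool) : R := if p then 2^-1 else - 2^-1.

Definition curl_crossings : crossings (fun _ : 'I_1 => @curl R).
refine (@Crossings R 1 (fun=> @curl R) bool (fun=> ord0) curl_param negb
  (fun p => if p then 1 else -1) _ _ negbK _ _ _).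
- by case; rewrite /curl_param; apply/andP; split; lra.
- by case=> -[] // _; rewrite /curl_param => h; exfalso; lra.
- by case; rewrite /curl_param /curl /=; congr pair; field.
- case; rewrite !(cubic_curve curl_cubic).2 /curl_param /det2 /=.
    by rewrite gtr0_sgz//; lra.
  by rewrite ltr0_sgz//; lra.
- move=> i u j v _ _; rewrite (ord1 i) (ord1 j) /curl => -[e1 e2] [/eqP//|uv].
  (* Equal ordinates give u^2 = v^2. Equal abscissas then leave 4 u^2 = 1, as u = 0 would make v
     equal to u. *)
  have vu : v = - u.
    apply/eqP; rewrite -addr_eq0.
    have : (v - u) * (v + u) = 0 by rewrite -subr_sqr; lra.
    by move/eqP; rewrite mulf_eq0 subr_eq0 eq_sym (negbTE uv).
  have u0 : u != 0 by apply: contra uv => /eqP u0; rewrite vu u0 oppr0.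
  have : u = 2^-1 \/ u = - 2^-1.
    have : (u - 2^-1) * (u + 2^-1) = 0.
      by apply: (mulfI u0); rewrite vu in e1; move: e1; rewrite sqrrN => e1; nra.
    move/eqP; rewrite mulf_eq0 subr_eq0 addr_eq0.
    by move=> /orP[] /eqP; [left|right].
  by case=> uE; [exists true|exists false]; rewrite vu uE /curl_param ?opprK.
Defined.

Section RI.
Variables (o : 'I_1 -> bool) (x : crossing_type).

Let X := orient_crossings curl_crossings curl_derivable o.

Let up (p : bool) : bool :=
  match x with
  | FirstOver => @cparam _ _ _ X p < @cparam _ _ _ X (~~ p)
  | SecondOver => @cparam _ _ _ X (~~ p) < @cparam _ _ _ X p
  | Virtual => false
  end.

Let upP p : reflect (RI_over x (@cstrand _ _ _ X p) (@cparam _ _ _ X p)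
   (@cstrand _ _ _ X (~~ p)) (@cparam _ _ _ X (~~ p))) (up p).
Proof. by rewrite /RI_over /up; case: x; apply: (iffP idP). Qed.

Let upN p : up p -> ~~ up (~~ p).
Proof. by rewrite /up negbK; case: x => // /ltW; rewrite leNgt. Qed.

Definition RI_chords : tangle_chords (Tangle (orient o (fun=> @curl R)) (RI_over x)) :=
  chords_of (X := X) upP upN.

Let mate_neq (p : endpoint RI_chords) : mate p != p.
Proof. by case: p. Qed.

Let mate_strand (p q : endpoint RI_chords) :
  (strand_of q == strand_of p) = (q == p) || (q == mate p).
Proof. by case: p q => [] []. Qed.

Lemma strand_total_RI i : strand_total RI_chords i = 0.
Proof.
apply: (strand_total0 mate_neq mate_strand) => p.
by rewrite tangle_sign_mate subrr.
Qed.

Lemma tangle_writhe_RI g n : n != 0 -> tangle_writhe RI_chords g n = 0.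
Proof. exact: (tangle_writhe_self_crossing mate_neq mate_strand). Qed.

End RI.
End Curl.

(** * The bigon: moves II *)

Section Bigon.
Variable R : realType.

Let bigon_cubic (i : 'I_2) (u : R) : bigon i u =
  if i == 0 :> nat then (cubic (0, 1, 0, 0) u, cubic (0, 0, 0, 0) u)
  else (cubic (0, 4 / 5, 0, 0) u, cubic (- 5^-1, 0, 4 / 5, 0) u).
Proof.
by rewrite /bigon; case: ifP => _; rewrite /cubic /=; congr pair; ring.
Qed.

Let bigon_derive (i : 'I_2) : (forall u, derivable (@bigon R i) u 1) /\
  (forall u, derive1 (@bigon R i) u =
     if i == 0 :> nat then (1, 0) else (4 / 5, 8 / 5 * u)).
Proof.
have := bigon_cubic i; case: (i == 0 :> nat) => /cubic_curve [d v]; split=> // u;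
  by rewrite v /=; congr pair; ring.
Qed.

Lemma bigon_derivable (i : 'I_2) u : derivable (@bigon R i) u 1.
Proof. exact: (bigon_derive i).1. Qed.

Let bigon_point : finType := ('I_2 * bool)%type.

(** The crossings have abscissas -2/5 and 2/5, reached on the parabola, of abscissa 4u/5, at the
    parameters -1/2 and 1/2. *)
Let bigon_param (p : bigon_point) : R :=
  (if p.2 then 1 else -1) * (if p.1 == 0 :> nat then 2 / 5 else 2^-1).

Let bigon_mate (p : bigon_point) : bigon_point := (rev_ord p.1, p.2).

Let bigon_bar (p : bigon_point) : bigon_point := (p.1, ~~ p.2).

Definition bigon_crossings : crossings (@bigon R).
refine (@Crossings R 2 (@bigon R) bigon_point fst bigon_param bigon_mate
  (fun p => if (p.1 == 0 :> nat) == p.2 then -1 else 1) _ _ _ _ _ _).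
- by move=> [i c]; rewrite /bigon_param; case: ifP => _; case: ifP => _;
    apply/andP; split; lra.
- move=> [i c] [j d] /= -> h; congr pair; move: h; rewrite /bigon_param /=.
  by case: c d => [] [] //; case: ifP => _ h; exfalso; lra.
- by move=> [i c]; rewrite /bigon_mate /= rev_ordK.
- by move=> [[[|[|//]] h] []]; rewrite /bigon /bigon_param /=; congr pair; field.
- move=> [[[|[|//]] h] []]; rewrite !(bigon_derive _).2 /bigon_param /det2 /=;
    first [rewrite gtr0_sgz //; lra|rewrite ltr0_sgz //; lra].
- have sq (u : R) : 4 * u ^+ 2 - 1 = 0 -> u = 2^-1 \/ u = - 2^-1.
    move=> e; have : (u - 2^-1) * (u + 2^-1) = 0 by nra.
    move/eqP; rewrite mulf_eq0 subr_eq0 addr_eq0.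
    by move=> /orP[] /eqP; [left|right].
  move=> i u j v _ _; case: i j => [[|[|//]] hi] [[|[|//]] hj];
    rewrite /bigon /= => e ne; have /= e1 := congr1 fst e;
    have /= e2 := congr1 snd e; clear e.
  + by case: ne => [//|/eqP uv]; exfalso; apply: uv; lra.
  + have [ve|ve] : v = 2^-1 \/ v = - 2^-1 by apply: sq; lra.
      exists (Ordinal hi, true).
      by split; rewrite /bigon_param //=; solve [exact: val_inj|lra].
    exists (Ordinal hi, false).
    by split; rewrite /bigon_param //=; solve [exact: val_inj|lra].
  + have [ve|ve] : u = 2^-1 \/ u = - 2^-1 by apply: sq; lra.
      exists (Ordinal hi, true).
      by split; rewrite /bigon_param //=; solve [exact: val_inj|lra].
    exists (Ordinal hi, false).
    by split; rewrite /bigon_param //=; solve [exact: val_inj|lra].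
  + by case: ne => [//|/eqP uv]; exfalso; apply: uv; lra.
Defined.

Section RII.
Variables (o : 'I_2 -> bool) (x : crossing_type).

Let X := orient_crossings bigon_crossings bigon_derivable o.

Let up (p : bigon_point) : bool := RII_over x p.1 (rev_ord p.1).

Let upN p : up p -> ~~ up (bigon_mate p).
Proof.
by rewrite /up; case: x; case: p => [[[|[|//]] h] c].
Qed.

Definition RII_chords :
    tangle_chords (Tangle (orient o (@bigon R)) (strand_over (RII_over x))) :=
  chords_of (X := X) (fun p => @idP (up p)) upN.

Let bar_neq (p : endpoint RII_chords) : bigon_bar p != p.
Proof. by case: p => i []; rewrite /bigon_bar xpair_eqE andbF. Qed.

Let bar_strand (p q : endpoint RII_chords) :
  (strand_of q == strand_of p) = (q == p) || (q == bigon_bar p).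
Proof.
case: p q => i c [j d]; rewrite /bigon_bar !xpair_eqE /=.
by case: (j == i); case: c d => [] [].
Qed.

Let bar_sign (p : endpoint RII_chords) :
  tangle_sign (bigon_bar p : endpoint RII_chords) = - tangle_sign p.
Proof.
rewrite /tangle_sign /real_endpoint /=; case: ifP => _; last by rewrite oppr0.
rewrite -mulrN; congr (_ * _).
by case: p => i c /=; case: (i == 0 :> nat); case: c.
Qed.

Lemma strand_total_RII i : strand_total RII_chords i = 0.
Proof.
apply: (strand_total0 bar_neq bar_strand) => p.
by rewrite bar_sign subrr.
Qed.

Lemma tangle_writhe_RII g n : tangle_writhe RII_chords g n = 0.
Proof. exact: (tangle_writhe_bigon bar_neq bar_strand). Qed.

End RII.
End Bigon.

(** * The grid: vp-moves *)

Section Grid.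
Variable R : realType.

Definition grid_strand (x y : bool) : 'I_4 :=
  if x then if y then @Ordinal 4 3 isT else @Ordinal 4 2 isT
  else if y then @Ordinal 4 1 isT else @Ordinal 4 0 isT.

Let grid_cubic (i : 'I_4) (u : R) : grid i u =
  match val i with
  | 0%N => (cubic (0, 4 / 5, 0, 0) u, cubic (3 / 5, 0, 0, 0) u)
  | 1%N => (cubic (0, - (4 / 5), 0, 0) u, cubic (- (3 / 5), 0, 0, 0) u)
  | 2%N => (cubic (3 / 5, 0, 0, 0) u, cubic (0, 4 / 5, 0, 0) u)
  | _ => (cubic (- (3 / 5), 0, 0, 0) u, cubic (0, - (4 / 5), 0, 0) u)
  end.
Proof.
by rewrite /grid; case: (val i) => [|[|[|?]]]; rewrite /cubic /=; congr pair; ring.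
Qed.

Let grid_derive (i : 'I_4) : (forall u, derivable (@grid R i) u 1) /\
  (forall u, derive1 (@grid R i) u =
     match val i with
     | 0%N => (4 / 5, 0)
     | 1%N => (- (4 / 5), 0)
     | 2%N => (0, 4 / 5)
     | _ => (0, - (4 / 5))
     end).
Proof.
have := grid_cubic i; case: (val i) => [|[|[|?]]] /cubic_curve [d v]; split=> // u;
  by rewrite v /=; congr pair; ring.
Qed.

Lemma grid_derivable (i : 'I_4) u : derivable (@grid R i) u 1.
Proof. exact: (grid_derive i).1. Qed.

(* (x, y, c): the point of the y-th strand of the pair x on the c-th strand of
   the other pair *)
Let grid_point : finType := (bool * bool * bool)%type.

(** The parameters solve 4u/5 = 3/5 up to sign; the sign depends on whether the two indices agree
    because the strands of a pair run in opposite directions. *)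
Let grid_param (p : grid_point) : R := if p.1.2 == p.2 then 3 / 4 else - (3 / 4).

Let grid_mate (p : grid_point) : grid_point := (~~ p.1.1, p.2, p.1.2).

Let grid_bar (p : grid_point) : grid_point := (p.1.1, p.1.2, ~~ p.2).

Let grid_exhaust (i : 'I_4) (u : R) (j : 'I_4) (v : R) : -1 < u < 1 -> -1 < v < 1 ->
    @grid R i u = grid j v -> i != j \/ u != v ->
  exists p : grid_point, [/\ grid_strand p.1.1 p.1.2 = i, grid_param p = u,
    grid_strand (~~ p.1.1) p.2 = j & grid_param (grid_mate p) = v].
Proof.
move=> _ _; case: i j => [[|[|[|[|//]]]] hi] [[|[|[|[|//]]]] hj];
    rewrite /grid /= => e ne; have /= e1 := congr1 fst e;
    have /= e2 := congr1 snd e; clear e.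
all: first
  [ (exfalso; lra)
  | (case: ne => [//|/eqP uv]; exfalso; apply: uv; lra)
  | (exists (false, false, false); split; rewrite /grid_param //=;
     [exact: val_inj|lra|exact: val_inj|lra])
  | (exists (false, false, true); split; rewrite /grid_param //=;
     [exact: val_inj|lra|exact: val_inj|lra])
  | (exists (false, true, false); split; rewrite /grid_param //=;
     [exact: val_inj|lra|exact: val_inj|lra])
  | (exists (false, true, true); split; rewrite /grid_param //=;
     [exact: val_inj|lra|exact: val_inj|lra])
  | (exists (true, false, false); split; rewrite /grid_param //=;
     [exact: val_inj|lra|exact: val_inj|lra])
  | (exists (true, false, true); split; rewrite /grid_param //=;
     [exact: val_inj|lra|exact: val_inj|lra])
  | (exists (true, true, false); split; rewrite /grid_param //=;
     [exact: val_inj|lra|exact: val_inj|lra])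
  | (exists (true, true, true); split; rewrite /grid_param //=;
     [exact: val_inj|lra|exact: val_inj|lra]) ].
Qed.

Definition grid_crossings : crossings (@grid R).
refine (@Crossings R 4 (@grid R) grid_point (fun p => grid_strand p.1.1 p.1.2)
  grid_param grid_mate
  (fun p => if p.1.1 == (p.1.2 == p.2) then 1 else -1) _ _ _ _ _ grid_exhaust).
- by move=> p; rewrite /grid_param; case: ifP => _; apply/andP; split; lra.
- move=> [[x y] c] [[x' y'] c'] /= /(congr1 val) e; rewrite /grid_param /= => h.
  have [<- <-] : (x, y) = (x', y') by move: x y x' y' e {h} => [] [] [] [].
  congr pair; move: e h; case: x y c x' y' c' => [] [] [] [] [] [] //= _ h;
    by exfalso; lra.
- by move=> [[[] []] []].
- by move=> [[[] []] []]; rewrite /grid /grid_param /=; congr pair; field.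
- move=> [[[] []] []]; rewrite !(grid_derive _).2 /det2 /=;
    first [rewrite gtr0_sgz //; lra|rewrite ltr0_sgz //; lra].
Defined.

Section VP.
Variables (w w' : bool).

Let o (i : 'I_4) : bool := if (i < 2)%N then w else w'.

Let X := orient_crossings grid_crossings grid_derivable o.

Let up (p : grid_point) : bool := ~~ p.1.1.

Let upP p : reflect (strand_over (@vp_over) (@cstrand _ _ _ X p) (@cparam _ _ _ X p)
  (@cstrand _ _ _ X (grid_mate p)) (@cparam _ _ _ X (grid_mate p))) (up p).
Proof. by case: p => [[[] []] []]; apply: (iffP idP). Qed.

Let upN p : up p -> ~~ up (grid_mate p).
Proof. by case: p => [[[] []] []]. Qed.

Definition vp_chords :
    tangle_chords (Tangle (orient o (@grid R)) (strand_over vp_over)) :=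
  chords_of (X := X) upP upN.

Let bar_neq (p : endpoint vp_chords) : grid_bar p != p.
Proof. by case: p => [[[] []] []]. Qed.

Let bar_strand (p q : endpoint vp_chords) :
  (strand_of q == strand_of p) = (q == p) || (q == grid_bar p).
Proof. by case: p q => [[[] []] []] [[[] []] []]. Qed.

(** A strand passes over both strands of the other pair or under both; as these run in opposite
    directions, its two endpoint signs cancel. *)
Lemma strand_total_vp i : strand_total vp_chords i = 0.
Proof.
apply: (strand_total0 bar_neq bar_strand) => p.
rewrite /tangle_sign /real_endpoint /=.
by case: p => [[[] []] []] /=; rewrite /o /=; case: w; case: w'.
Qed.

Lemma card_vp : #|[pred p : endpoint vp_chords | upper p]| = 4%N.
Proof.
rewrite (@eq_card grid_point _
  [predX [predX pred1 false & [pred _ : bool | true]] & [pred _ : bool | true]]).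
  by rewrite !cardX card1 !cardT -!cardE !card_bool.
by case=> [[[] []] []].
Qed.

End VP.
End Grid.

Section Ends.
Variable R : realType.

(** Naming the ends by signs makes the property insensitive to the orientation of the strands. It
    yields the hypothesis of [chart_apart]. *)
Definition distinct_ends k (c : 'I_k -> R -> plane R) : Prop :=
  forall i j (e e' : bool), c i ((-1) ^+ e) = c j ((-1) ^+ e') -> i = j /\ e = e'.

Lemma orient_ends k (c : 'I_k -> R -> plane R) (o : 'I_k -> bool) i j :
  distinct_ends c -> orient o c i (-1) != orient o c j 1.
Proof.
have sN (e : bool) : (-1) ^+ e * -1 = (-1) ^+ (~~ e) :> R by case: e => /=; ring.
move=> dc; apply/eqP; rewrite /orient mulr1 sN => /dc[ij].
by rewrite ij; case: (o j).
Qed.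

Lemma curl_ends : distinct_ends (fun _ : 'I_1 => @curl R).
Proof.
move=> i j e e'; rewrite (ord1 i) (ord1 j) /curl => h; split=> //.
by have := congr1 fst h; case: e {h}; case: e' => //= h; exfalso; lra.
Qed.

Lemma bigon_ends : distinct_ends (@bigon R).
Proof.
move=> [[|[|//]] hi] [[|[|//]] hj] e e'; rewrite /bigon /= => h;
  have /= e1 := congr1 fst h; have /= e2 := congr1 snd h; move: e1 e2 {h};
  case: e; case: e' => //= e1 e2; first [by exfalso; lra|by split=> //; exact: val_inj].
Qed.

Lemma triangle_ends : distinct_ends (@triangle R).
Proof.
move=> [[|[|[|//]]] hi] [[|[|[|//]]] hj] e e';
  rewrite /triangle /segment /= !planeD !planeZ /= => h;
  have /= e1 := congr1 fst h; have /= e2 := congr1 snd h; move: e1 e2 {h};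
  case: e; case: e' => //= e1 e2; first [by exfalso; lra|by split=> //; exact: val_inj].
Qed.

Lemma grid_ends : distinct_ends (@grid R).
Proof.
move=> [[|[|[|[|//]]]] hi] [[|[|[|[|//]]]] hj] e e';
  rewrite /grid /= => h;
  have /= e1 := congr1 fst h; have /= e2 := congr1 snd h; move: e1 e2 {h};
  case: e; case: e' => //= e1 e2; first [by exfalso; lra|by split=> //; exact: val_inj].
Qed.

End Ends.

(** * Bounds on the writhes *)

Section Invariance.
Variable R : realType.
Implicit Types D : diagram R.

Lemma parallel_derivable (i : 'I_2) u : derivable (@parallel R i) u 1.
Proof.
have [|d _] := @cubic_curve R (@parallel R i)
    (0, if i == 0 :> nat then 1 else 4 / 5, 0, 0)
    (if i == 0 :> nat then 0 else 3 / 5, 0, 0, 0); last exact: d.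
move=> {}u; rewrite /parallel /cubic /=.
by case: (i == 0 :> nat); congr pair; ring.
Qed.

Lemma no_over_writhe k (c c' : 'I_k -> R -> plane R) t
    (C : tangle_chords (Tangle c t)) D D' :
    (forall i u, derivable (c i) u 1) -> (forall i u, derivable (c' i) u 1) ->
    (forall i j, c i (-1) != c j 1) -> (forall i, strand_total C i = 0) ->
    local_move (Tangle c t) (Tangle c' (@no_over R k)) D D' ->
  exists g, forall n, diagram_writhe D' n - diagram_writhe D n = - tangle_writhe C g n.
Proof.
move=> dc dc' ends tot lm.
have totE i : strand_total (chords_void c') i = strand_total C i.
  by rewrite strand_total_void tot.
have [g gE] := @local_move_writhe R k (Tangle c t) (Tangle c' (@no_over R k))
  C (chords_void c') D D' dc dc' ends totE lm.
by exists g => n; rewrite gE tangle_writhe_void sub0r.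
Qed.

Lemma reidemeister_writhe D D' (n : int) : n != 0 -> reidemeister_move D D' ->
  diagram_writhe D' n = diagram_writhe D n.
Proof.
move=> n0 [k [T [T' [rT]]]]; case: rT => [ o x| o x| o h hR] lm; apply/eqP;
  rewrite -subr_eq0.
- have dc := @orient_derivable _ _ _ (@curl_derivable R) o.
  have ds := @orient_derivable R 1 _
    (fun _ => (segment_curve (- (3 / 5), 4 / 5) (3 / 5, 4 / 5)).1) o.
  have ends i j := orient_ends o i j (@curl_ends R).
  have [g gE] := no_over_writhe dc ds ends (strand_total_RI R o x) lm.
  by rewrite gE tangle_writhe_RI// oppr0.
- have dc := @orient_derivable _ _ _ (@bigon_derivable R) o.
  have ds := @orient_derivable R _ _ parallel_derivable o.
  have ends i j := orient_ends o i j (@bigon_ends R).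
  have [g gE] := no_over_writhe dc ds ends (strand_total_RII R o x) lm.
  by rewrite gE tangle_writhe_RII oppr0.
- have asym p : triangle_upper h p -> ~~ triangle_upper h (triangle_mate p).
    exact: RIII_asym.
  have dc := @orient_derivable _ _ _ (@triangle_derivable R) o.
  have ds := @orient_derivable _ _ _ (@opposite_triangle_derivable R) o.
  have ends i j := orient_ends o i j (@triangle_ends R).
  have [g gE] := @local_move_writhe R 3 _ _ (triangle_chords R o asym)
    (opposite_triangle_chords R o asym) D D' dc ds ends
    (strand_total_opposite R o asym) lm.
  by rewrite gE tangle_writhe_opposite ?subrr// => p; exact: RIII_third.
Qed.

Lemma equivalent_writhe D D' (n : int) : n != 0 -> equivalent D D' ->
  diagram_writhe D n = diagram_writhe D' n.
Proof.
move=> n0; elim=> {D D'} [D D' h|D|D D' _ e|D1 D2 D3 _ e1 _ e2].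
- case: h => h; first exact (esym (planar_isotopic_writhe n h)).
  exact (esym (reidemeister_writhe n0 h)).
- exact erefl.
- exact (esym e).
- exact (etrans e1 e2).
Qed.

(** Finite lists of indices suffice, since the sum in the theorem is the supremum of its finite
    partial sums. *)
Definition writhe_distance (s : seq int) D D' : int :=
  \sum_(n <- s) `|diagram_writhe D n - diagram_writhe D' n|.

Lemma writhe_distanceC s D D' : writhe_distance s D D' = writhe_distance s D' D.
Proof. apply: eq_bigr => n _; exact (distrC _ _). Qed.

Lemma virtualization_writhe k (c : 'I_k -> R -> plane R) t
    (C : tangle_chords (Tangle c t)) D D' (s : seq int) :
    uniq s -> (forall i u, derivable (c i) u 1) ->
    (forall i j, c i (-1) != c j 1) -> (forall i, strand_total C i = 0) ->
    local_move (Tangle c t) (Tangle c (@no_over R k)) D D' ->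
  writhe_distance s D D' <= (#|[pred p : endpoint C | upper p]|)%:Z.
Proof.
move=> us dc ends tot lm.
have [g gE] := no_over_writhe dc dc ends tot lm.
rewrite writhe_distanceC /writhe_distance.
under eq_bigr => n _ do rewrite gE normrN.
exact: sum_normr_tangle_writhe.
Qed.

Lemma vDelta_writhe s D D' : uniq s -> vDelta_move D D' ->
  writhe_distance s D D' <= 3%N%:Z.
Proof.
move=> us [T [T' [vT]]]; case: vT => w x.
have bound E E' : local_move (Tangle (orient (fun=> w) (@triangle R))
      (strand_over (vDelta_over x)))
    (Tangle (orient (fun=> w) (@triangle R)) (@no_over R 3)) E E' ->
    writhe_distance s E E' <= 3%N%:Z.
  move=> lm; rewrite -(card_vDelta R w x).
  apply: (virtualization_writhe us _ _ _ lm).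
  - by apply: orient_derivable; exact: triangle_derivable.
  - by move=> i j; apply: orient_ends; exact: triangle_ends.
  - exact: strand_total_vDelta.
by case=> [/bound//|/bound]; rewrite writhe_distanceC.
Qed.

Lemma vp_writhe s D D' : uniq s -> vp_move D D' ->
  writhe_distance s D D' <= 4%N%:Z.
Proof.
move=> us [T [T' [vT]]]; case: vT => w w' o.
have bound E E' : local_move (Tangle (orient o (@grid R)) (strand_over vp_over))
    (Tangle (orient o (@grid R)) (@no_over R 4)) E E' ->
    writhe_distance s E E' <= 4%N%:Z.
  move=> lm; rewrite -(card_vp R w w').
  apply: (virtualization_writhe us _ _ _ lm).
  - by apply: orient_derivable; exact: grid_derivable.
  - by move=> i j; apply: orient_ends; exact: grid_ends.
  - exact: strand_total_vp.
by case=> [/bound//|/bound]; rewrite writhe_distanceC.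
Qed.

(** * From one move to the distance *)

Section Deformation.
Variables (X : diagram R -> diagram R -> Prop) (m : nat).
Hypothesis X_writhe : forall s D D', uniq s -> X D D' ->
  writhe_distance s D D' <= m%:Z.

Lemma deforms_writhe s N D D' : uniq s -> {in s, forall n, n != 0} ->
  deforms X N D D' -> writhe_distance s D D' <= (m * N)%N%:Z.
Proof.
move=> us s0; elim=> {N D D'} [D D' e|N D1 D2 D3 D4 _ IH x e].
  rewrite /writhe_distance big_seq big1 ?muln0// => n ns.
  by rewrite (equivalent_writhe (s0 n ns) e) subrr normr0.
rewrite mulnS addnC PoszD; apply: le_trans (lerD IH (X_writhe us x)).
rewrite /writhe_distance -big_split /= big_seq [leRHS]big_seq.
apply: ler_sum => n ns; rewrite -(equivalent_writhe (s0 n ns) e).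
exact: ler_distD.
Qed.

Lemma writheE (K : virtual_knot R) D (n : int) : n != 0 ->
  \pi_(virtual_knot R) D = K -> writhe n K = diagram_writhe D n.
Proof.
move=> n0 DK; apply: equivalent_writhe => //.
have : \pi_(virtual_knot R) (repr K) = \pi_(virtual_knot R) D by rewrite reprK DK.
by move/eqquotP/asboolP.
Qed.

Lemma distance_writhe (K K' : virtual_knot R) : (0 < m)%N ->
  ((m%:R^-1)%R%:E * (\esum_(n in [set n : int | n != 0])
     (`|writhe n K - writhe n K'|%:~R)%:E)%R <= distance X K K')%E.
Proof.
(* The distance is an infimum and the sum a supremum, so it is enough to compare one deformation
   with N moves and one finite set A of indices. *)
move=> m0; apply/ereal_infP => _ [N [D [D' [DK DK' dXN]]] <-].
rewrite lee_pdivrMl ?ltr0n//; apply: ge_ereal_sup => _ [A [fA A0] <-].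
rewrite fsumEFin// -EFinM lee_fin -natrM fsbig_finite//=.
pose s : seq int := finmap.enum_fset (fset_set A).
have us : uniq s by exact: finmap.fset_uniq.
have s0 : {in s, forall n, n != 0}.
  by move=> n; rewrite in_fset_set// inE => /A0.
have bound := deforms_writhe us s0 dXN; rewrite -(ler_int R) in bound.
apply: le_trans bound; rewrite /writhe_distance rmorph_sum /=.
rewrite [leLHS]big_seq [leRHS]big_seq; apply: ler_sum => n /s0 n0.
rewrite (writheE n0 DK) (writheE n0 DK'); exact (lexx _).
Qed.

End Deformation.

Lemma writhe_trivial_knot (n : int) : n != 0 -> writhe n (trivial_knot R) = 0.
Proof.
move=> n0; rewrite (writheE n0 (erefl _)) /diagram_writhe.
by apply: fsbig1 => c [[]].
Qed.

End Invariance.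

Theorem proposition5p3 (R : realType) (K K' : virtual_knot R) :
  let S := \esum_(n in [set n : int | n != 0])
             (`|writhe n K - writhe n K'|%:~R)%:E : \bar R in
  let S0 := \esum_(n in [set n : int | n != 0])
             (`|writhe n K|%:~R)%:E : \bar R in
  [/\ ((3^-1)%R%:E * S <= distance (@vDelta_move R) K K')%E,
      ((4^-1)%R%:E * S <= distance (@vp_move R) K K')%E,
      ((3^-1)%R%:E * S0 <= unknotting (@vDelta_move R) K)%E
    & ((4^-1)%R%:E * S0 <= unknotting (@vp_move R) K)%E].
Proof.
move=> S S0.
have S0E : S0 = \esum_(n in [set n : int | n != 0])
    (`|writhe n K - writhe n (trivial_knot R)|%:~R)%:E.
  by apply: eq_esum => n /= n0; rewrite writhe_trivial_knot// subr0.
by split; rewrite ?S0E; apply: distance_writhe => // s D D';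
  [exact: vDelta_writhe|exact: vp_writhe|exact: vDelta_writhe|exact: vp_writhe].
Qed.
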